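(* Let $G$ be a compact topological group, let $H$ be a closed subgroup of $G$, and let $X$ be a $p$-paracompact $G$-space. If $X$ is equivariantly movable ($G$-movable), then the $H$-fixed point space $X[H]=\{x\in X: hx=x \text{ for all } h\in H\}$ is movable.
   Context: Conventions: all topological groups $G$ are compact (Hausdorff) and all topological spaces are $p$-paracompact, i.e. paracompact $p$-spaces in the sense of Arhangel'skii (equivalently, Hausdorff spaces admitting a perfect map onto a metrizable space). A $G$-space is a space with a continuous action $G\times X\to X$; a $G$-map is a continuous equivariant map; a $G$-homotopy is an equivariant homotopy $X\times I\to Y$ ($G$ acting trivially on $I=[0,1]$), and $G$-homotopy classes of $G$-maps are composed via representatives. $P_G$ is the class of $p$-paracompact $G$-spaces. A $G$-space $Y$ is a $G$-$ANR(P_G)$ if $Y\in P_G$ and whenever $Y$ is a closed invariant subset of a $G$-space $Z\in P_G$, there exist an invariant neighborhood $U$ of $Y$ in $Z$ and a $G$-map $r:U\to Y$ with $r|_Y=1_Y$. Below, ''$G$-$ANR$'' means $G$-$ANR(P_G)$. An inverse $G$-system $\underline{X}=\{X_\alpha,p_{\alpha\alpha'},A\}$ consists of $G$-spaces $X_\alpha$ indexed by a directed set $A$ and $G$-homotopy classes $p_{\alpha\alpha'}:X_{\alpha'}\to X_\alpha$ for $\alpha\le\alpha'$, with $p_{\alpha\alpha}=\mathrm{id}$ and $p_{\alpha\alpha'}p_{\alpha'\alpha''}=p_{\alpha\alpha''}$. It is $G$-movable (equivariantly movable) if for every $\alpha\in A$ there is $\alpha'\ge\alpha$ such that for all $\alpha''\ge\alpha$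 there is a $G$-homotopy class $r^{\alpha'\alpha''}:X_{\alpha'}\to X_{\alpha''}$ with $p_{\alpha\alpha''}\circ r^{\alpha'\alpha''}=p_{\alpha\alpha'}$. An inverse $G$-$ANR$-system (one whose terms are $G$-$ANR$'s) is associated with $X$ (in the sense of Morita; equivalently, it is a $G$-$ANR$-expansion of $X$) if there are $G$-homotopy classes $p_\alpha:X\to X_\alpha$ with $p_\alpha=p_{\alpha\alpha'}p_{\alpha'}$ for $\alpha\le\alpha'$ such that for every $G$-$ANR$ $K$: (i) each $G$-homotopy class $h:X\to K$ has the form $h=f p_\alpha$ for some $\alpha$ and some $G$-homotopy class $f:X_\alpha\to K$; (ii) if $f,f':X_\alpha\to K$ are $G$-homotopy classes with $fp_\alpha=f'p_\alpha$, then $fp_{\alpha\alpha'}=f'p_{\alpha\alpha'}$ for some $\alpha'\ge\alpha$. A $G$-space $X$ is $G$-movable (equivariantly movable) if there is a $G$-movable inverse $G$-$ANR$-system associated with $X$. A topological space is movable if it is $\{e\}$-movable for the trivial group $\{e\}$. *)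

(* Defs.v *)
(* The reals, hence the interval [0, 1] and all
   metrics, are those of an arbitrary R : realType. *)
From HB Require Import structures.
From mathcomp Require Import all_boot all_order all_algebra.
From mathcomp Require Import all_classical all_reals topology.

Set Implicit Arguments.
Unset Strict Implicit.
Unset Printing Implicit Defensive.

Import numFieldTopology.Exports.

Local Open Scope classical_set_scope.
Local Open Scope ring_scope.
Local Open Scope group_scope.

HB.mixin Record isTopologicalGroup G of Topological G & Group G := {
  mulg_continuous : continuous (fun z : G * G => z.1 * z.2 : G);
  invg_continuous : continuous (fun x : G => x^-1 : G)
}.

#[short(type="topGroupType")]
HB.structure Definition TopologicalGroup :=
  {G of Topological G & Group G & isTopologicalGroup G}.

Definition closed_subgroup (G : topGroupType) (H : set G) : Prop :=
  [/\ closed H, H 1, (forall x y, H x -> H y -> H (x * y)) &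
      (forall x, H x -> H x^-1)].

Definition trivial_group : Type := unit.

Section TrivialGroup.
Let m (_ _ : trivial_group) : trivial_group := tt.
Let i (_ : trivial_group) : trivial_group := tt.
Fact trivial_mulgA : associative m. Proof. by []. Qed.
Fact trivial_mul1g : left_id tt m. Proof. by case. Qed.
Fact trivial_mulg1 : right_id tt m. Proof. by case. Qed.
Fact trivial_mulVg : left_inverse tt i m. Proof. by []. Qed.
Fact trivial_mulgV : right_inverse tt i m. Proof. by []. Qed.
HB.instance Definition _ := Choice.copy trivial_group unit.
HB.instance Definition _ := isGroup.Build trivial_group
  trivial_mulgA trivial_mul1g trivial_mulg1 trivial_mulVg trivial_mulgV.

Let op (_ : set trivial_group) := True.
Fact trivial_opT : op setT. Proof. by []. Qed.
Fact trivial_opI : setI_closed op. Proof. by []. Qed.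
Fact trivial_op_bigU (I : Type) (f : I -> set trivial_group) :
  (forall k, op (f k)) -> op (\bigcup_k f k).
Proof. by []. Qed.
HB.instance Definition _ := isOpenTopological.Build trivial_group
  trivial_opT trivial_opI trivial_op_bigU.

Fact trivial_mulg_continuous :
  continuous (fun z : trivial_group * trivial_group =>
    z.1 * z.2 : trivial_group).
Proof. exact: cst_continuous. Qed.
Fact trivial_invg_continuous :
  continuous (fun x : trivial_group => x^-1 : trivial_group).
Proof. exact: cst_continuous. Qed.
HB.instance Definition _ := isTopologicalGroup.Build trivial_group
  trivial_mulg_continuous trivial_invg_continuous.
End TrivialGroup.

Record gspace (G : topGroupType) := GSpace {
  gcarrier :> topologicalType;
  gact : G -> gcarrier -> gcarrier;
  gact1 : forall x, gact 1 x = x;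
  gactM : forall g h x, gact (g * h) x = gact g (gact h x);
  gact_continuous : continuous (fun z : G * gcarrier => gact z.1 z.2)
}.

Record gmap (G : topGroupType) (X Y : gspace G) := GMap {
  gfun :> X -> Y;
  gfun_continuous : continuous gfun;
  gfun_equivariant : forall g x, gfun (gact g x) = gact g (gfun x)
}.

Definition gid (G : topGroupType) (X : gspace G) : gmap X X.
Proof. by exists (fun x => x) => // x; exact: cvg_id. Defined.

Definition gcomp (G : topGroupType) (X Y Z : gspace G)
  (f : gmap Y Z) (p : gmap X Y) : gmap X Z.
Proof.
exists (fun x => f (p x)).
- move=> x; apply: (@continuous_comp _ _ _ p f x).
  + exact: gfun_continuous.
  + exact: gfun_continuous.
- by move=> g x; rewrite !gfun_equivariant.
Defined.

(* G-homotopy classes are handled through representatives: a class is given by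
   a G-map, and equality of classes is ghomotopic. *)
Definition ghomotopic (R : realType) (G : topGroupType) (X Y : gspace G)
    (f0 f1 : gmap X Y) : Prop :=
  exists F : X * R -> Y,
    [/\ {within [set: X] `*` `[0%R, 1%R], continuous F},
        (forall g x (t : R), t \in `[0%R, 1%R] ->
           F (gact g x, t) = gact g (F (x, t))),
        (forall x, F (x, 0%R) = f0 x) &
        (forall x, F (x, 1%R) = f1 x)].

Definition perfect_map (X Y : topologicalType) (f : X -> Y) : Prop :=
  [/\ continuous f,
      (forall y, exists x, f x = y),
      (forall C, closed C -> closed (f @` C)) &
      (forall y, compact (f @^-1` [set y]))].

(* Paracompact p-spaces in the sense of Arhangel'skii, in the form: Hausdorff
   spaces that admit a perfect map onto a metrizable space. *)
Definition p_paracompact (R : realType) (X : topologicalType) : Prop :=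
  hausdorff_space X /\
  exists (M : metricType R) (f : X -> M), perfect_map f.

Definition invariant_set (G : topGroupType) (X : gspace G) (U : set X) : Prop :=
  forall g x, U x -> U (gact g x).

Section SubGSpace.
Variables (G : topGroupType) (X : gspace G) (U : set X).
Hypothesis Uinv : invariant_set U.

Definition sub_act (g : G) (u : U) : U :=
  SigSub (mem_set (Uinv g (set_mem (valP u)))).

Fact sub_act1 u : sub_act 1 u = u.
Proof. by apply: val_inj; rewrite /= gact1. Qed.

Fact sub_actM g h u : sub_act (g * h) u = sub_act g (sub_act h u).
Proof. by apply: val_inj; rewrite /= gactM. Qed.

Fact sub_act_continuous : continuous (fun z : G * U => sub_act z.1 z.2).
Proof.
apply: (@continuous_comp_initial U (G * U)%type X set_val) => z.
apply: (@continuous_comp _ _ _ (fun z : G * U => (z.1, set_val z.2))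
  (fun z : G * X => gact z.1 z.2) z); last exact: gact_continuous.
apply: cvg_pair; first exact: cvg_fst.
apply: (@continuous_comp _ _ _ snd set_val z); first exact: cvg_snd.
exact: initial_continuous.
Qed.

Definition sub_gspace : gspace G :=
  GSpace sub_act1 sub_actM sub_act_continuous.
End SubGSpace.

(* Homeomorphism onto a closed subspace. *)
Definition closed_embedding (Y Z : topologicalType) (i : Y -> Z) : Prop :=
  [/\ continuous i, injective i & (forall C, closed C -> closed (i @` C))].

(* Y sits in Z as a closed invariant subset through an equivariant closed
   embedding i.  The retraction is defined on U only, so that the empty G-space
   qualifies. *)
Definition is_ganr (R : realType) (G : topGroupType) (Y : gspace G) : Prop :=
  p_paracompact R Y /\
  forall (Z : gspace G) (i : gmap Y Z),
    p_paracompact R Z -> closed_embedding i ->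
    exists (U : set Z) (Uinv : invariant_set U) (r : gmap (sub_gspace Uinv) Y),
      (forall y, nbhs (i y) U) /\
      (forall (y : Y) (u : sub_gspace Uinv), set_val u = i y -> r u = y).

Record gsystem (R : realType) (G : topGroupType) := GSystem {
  sidx : Type;
  sle : sidx -> sidx -> Prop;
  sle_refl : forall a, sle a a;
  sle_trans : forall a b c, sle a b -> sle b c -> sle a c;
  sidx_inhabited : inhabited sidx;
  sle_directed : forall a b, exists c, sle a c /\ sle b c;
  sobj : sidx -> gspace G;
  sbond : forall a b, sle a b -> gmap (sobj b) (sobj a);
  sbond_id : forall a (aa : sle a a), ghomotopic R (sbond aa) (gid (sobj a));
  sbond_comp : forall a b c (ab : sle a b) (bc : sle b c) (ac : sle a c),
    ghomotopic R (gcomp (sbond ab) (sbond bc)) (sbond ac)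
}.

Definition movable_system (R : realType) (G : topGroupType)
    (S : gsystem R G) : Prop :=
  forall a : sidx S, exists (a' : sidx S) (aa' : sle a a'),
    forall (a'' : sidx S) (aa'' : sle a a''),
      exists r : gmap (sobj a') (sobj a''),
        ghomotopic R (gcomp (sbond aa'') r) (sbond aa').

Definition associated_with (R : realType) (G : topGroupType)
    (S : gsystem R G) (X : gspace G) : Prop :=
  exists p : forall a : sidx S, gmap X (sobj a),
    (forall (a a' : sidx S) (aa' : sle a a'),
       ghomotopic R (p a) (gcomp (sbond aa') (p a'))) /\
    forall K : gspace G, is_ganr R K ->
      (forall h : gmap X K, exists (a : sidx S) (f : gmap (sobj a) K),
         ghomotopic R h (gcomp f (p a))) /\
      (forall (a : sidx S) (f f' : gmap (sobj a) K),
         ghomotopic R (gcomp f (p a)) (gcomp f' (p a)) ->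
         exists (a' : sidx S) (aa' : sle a a'),
           ghomotopic R (gcomp f (sbond aa')) (gcomp f' (sbond aa'))).

Definition gmovable (R : realType) (G : topGroupType) (X : gspace G) : Prop :=
  exists S : gsystem R G,
    [/\ (forall a : sidx S, is_ganr R (sobj a)), movable_system S &
        associated_with S X].

Section TrivialAction.
Variables (G : topGroupType) (X : topologicalType).
Fact trivial_act_continuous : continuous (fun z : G * X => z.2).
Proof. by move=> z; exact: cvg_snd. Qed.
Definition trivial_gspace : gspace G :=
  @GSpace G X (fun _ x => x) (fun _ => erefl) (fun _ _ _ => erefl)
    trivial_act_continuous.
End TrivialAction.

Definition movable (R : realType) (X : topologicalType) : Prop :=
  gmovable R (trivial_gspace trivial_group X).

Definition fixed_points (G : topGroupType) (X : gspace G) (H : set G) : set X :=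
  [set x | forall h, H h -> gact h x = x].

Arguments fixed_points {G} X H.

(* Main.v *)
Require Import Defs.
From HB Require Import structures.
From mathcomp Require Import all_boot all_order all_algebra.
From mathcomp Require Import all_classical all_reals topology.
From mathcomp Require normed_module.
From mathcomp Require Import wochoice lra.

(* The terms of an associated system are replaced by neighbourhoods of X.  A
   p-paracompact G-space X embeds as a closed G-subset into a p-paracompact
   G-space Z which is an equivariant absolute extensor even for maps that are
   equivariant only under a subset H of G; for maps from spaces with the trivial
   action this says that the fixed point space Z[H] is an absolute extensor.
   The cozero sets U of invariant functions on Z that are positive on X are then
   G-ANRs, and the U[H] are ANRs.  A G-movable system associated with X makes
   the neighbourhoods U G-movable (maps and homotopies given on X extend to
   neighbourhoods of X), movability passes to the U[H] by restriction, and every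
   neighbourhood of X[H] in Z[H] contains some U[H], so that the system of the
   U[H] is associated with X[H].

   Extensions are obtained from pseudometrics.  A perfect map onto a metrizable
   space is encoded by a continuous pseudometric for which d(x, .) -> 0 along an
   ultrafilter forces convergence.  Neighbourhoods of the diagonal of a
   p-paracompact space have half-size refinements, whence any equicontinuous
   family of functions on a closed subset is Lipschitz for some continuous
   pseudometric of the whole space, and McShane's formula extends it. *)

Set Implicit Arguments.
Unset Strict Implicit.
Unset Printing Implicit Defensive.

Import Order.TTheory GRing.Theory Num.Theory.
Import numFieldTopology.Exports.

Local Open Scope classical_set_scope.
Local Open Scope ring_scope.

(** * Continuous pseudometrics and perfect maps *)

(** Taking H-fixed points in the terms of the given system does not work: a map from X[H] to an ANR
    is in general not the restriction of a G-map on X, so the expansion property of X, which tests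
    only G-maps into G-ANRs, says nothing about it. With neighbourhoods in a fixed Z, extending a
    map from X[H] over part of Z[H] needs only that the target is an ANR, and the given system
    serves solely to prove that the neighbourhoods of X are movable. A perfect map onto a metrizable
    space may identify points, so Z needs a compact factor to separate the points of X, beside a
    metrizable factor in which the image of X is controlled. McShane's formula suits the equivariant
    setting because it is a supremum: reparametrising the index set shows that it respects the
    symmetries, without any averaging over G. It extends a whole family of functions with one
    pseudometric, which makes the extension continuous for the uniform metric on the metrizable
    factor. *)

Section SupR.
Context {R : realType} {I : Type}.
Implicit Types f g : I -> R.

(* The supremum of the empty family is 0. *)
Definition supr f : R := sup (range f).

Lemma supr_ub f i : (forall j, f j <= 1) -> f i <= supr f.
Proof.
move=> f1; apply: ub_le_sup; last by exists i.
by exists 1 => _ [j _ <-].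
Qed.

Lemma supr_le f e : 0 <= e -> (forall i, f i <= e) -> supr f <= e.
Proof.
move=> e0 fe; rewrite /supr.
have [[i _]|/nonemptyPn] := pselect ([set: I] !=set0).
  by apply: ge_sup; [exists (f i), i|move=> _ [j _ <-]].
by move=> I0; rewrite I0 image_set0 sup0.
Qed.

Lemma supr_ge0 f : (forall j, 0 <= f j <= 1) -> 0 <= supr f.
Proof.
move=> f1; rewrite /supr.
have [[i _]|/nonemptyPn] := pselect ([set: I] !=set0).
  have /andP[fi _] := f1 i; apply: (le_trans fi); apply: supr_ub => j.
  by have /andP[] := f1 j.
by move=> I0; rewrite I0 image_set0 sup0.
Qed.

Lemma supr_le1 f : (forall j, f j <= 1) -> supr f <= 1.
Proof. by move=> f1; apply: supr_le. Qed.

Lemma supr_in01 f : (forall j, 0 <= f j <= 1) -> 0 <= supr f <= 1.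
Proof.
move=> f1; rewrite supr_ge0//= supr_le1// => j; by have /andP[] := f1 j.
Qed.

Lemma supr_leD f g e : 0 <= e -> (forall j, 0 <= g j <= 1) ->
  (forall i, f i <= g i + e) -> supr f <= supr g + e.
Proof.
move=> e0 g1 fg; apply: supr_le; first by rewrite addr_ge0 ?supr_ge0.
move=> i; apply: (le_trans (fg i)); rewrite lerD2r; apply: supr_ub => j.
by have /andP[] := g1 j.
Qed.

(** Suprema inherit a common modulus of continuity; the continuity of every function built below as
    a supremum rests on this. *)
Lemma supr_dist f g e : 0 <= e ->
  (forall j, 0 <= f j <= 1) -> (forall j, 0 <= g j <= 1) ->
  (forall i, `|f i - g i| <= e) -> `|supr f - supr g| <= e.
Proof.
move=> e0 f1 g1 fg.
have A := @supr_leD f g e e0 g1; have B := @supr_leD g f e e0 f1.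
rewrite ler_norml; apply/andP; split.
  rewrite -subr_ge0 opprK addrAC subr_ge0; apply: B => i.
  by have := fg i; rewrite ler_norml => /andP[]; lra.
rewrite lerBlDl; apply: (le_trans (A _)); last by rewrite addrC.
by move=> i; have := fg i; rewrite ler_norml => /andP[]; lra.
Qed.
Lemma supr_gt f c : (forall j, f j <= 1) -> 0 <= c -> c < supr f ->
  exists i, c < f i.
Proof.
move=> f1 c0 cf; apply: contrapT => H.
have : supr f <= c.
  by apply: supr_le => // i; rewrite leNgt; apply/negP => ci; apply: H;
    exists i.
by rewrite leNgt cf.
Qed.

End SupR.

Section Pseudometric.
Context {R : realType}.

(** The bound 1 makes suprema over arbitrary families meaningful. Smallness near the diagonal
    suffices for joint continuity, by the triangle inequality. *)
Definition cpmetric (T : topologicalType) (D : T -> T -> R) : Prop :=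
  [/\ (forall x, D x x = 0), (forall x y, D x y = D y x),
      (forall x y z, D x z <= D x y + D y z), (forall x y, D x y <= 1) &
      (forall x e, 0 < e -> \forall y \near x, D x y < e)].

Lemma cpmetric_ge0 (T : topologicalType) (D : T -> T -> R) x y :
  cpmetric D -> 0 <= D x y.
Proof.
by case=> Dxx Dsym Dtri _ _; have := Dtri x y x; rewrite Dxx (Dsym y x); lra.
Qed.

Lemma cpmetric_in01 (T : topologicalType) (D : T -> T -> R) x y :
  cpmetric D -> 0 <= D x y <= 1.
Proof. by move=> cD; rewrite cpmetric_ge0//=; case: cD => _ _ _ D1 _. Qed.

Lemma cpmetric_dist (T : topologicalType) (D : T -> T -> R) x y z :
  cpmetric D -> `|D x z - D y z| <= D x y.
Proof.
case=> Dxx Dsym Dtri _ _; rewrite ler_norml.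
by have := Dtri x y z; have := Dtri y x z; rewrite (Dsym y x); lra.
Qed.

Lemma real_continuous (T : topologicalType) (f : T -> R) :
  (forall x e, 0 < e -> \forall y \near x, `|f x - f y| < e) <-> continuous f.
Proof.
split=> H x.
  by apply/cvg_ballP => e e0; exact: H.
by move=> e e0; have /cvg_ballP/(_ _ e0) := H x.
Qed.
Lemma lipschitz_continuous (T : topologicalType) (D : T -> T -> R)
    (f : T -> R) :
  cpmetric D -> (forall x y, `|f x - f y| <= D x y) -> continuous f.
Proof.
move=> cD fD; apply/real_continuous => x e e0; case: cD => _ _ _ _ /(_ x e e0).
by apply: filterS => y; exact: le_lt_trans.
Qed.

Lemma cpmetric_cst0 (T : topologicalType) : cpmetric (fun _ _ : T => 0 : R).
Proof. by split=> // *; [rewrite addr0|exact: nearW]. Qed.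

Lemma cpmetric_comp (T U : topologicalType) (f : T -> U) (D : U -> U -> R) :
  continuous f -> cpmetric D -> cpmetric (fun x y => D (f x) (f y)).
Proof.
move=> cf [D0 Ds Dt D1 Dc]; split=> // x e e0.
exact: (cf x _ (Dc (f x) e e0)).
Qed.

Lemma cpmetric_max (T : topologicalType) (D D' : T -> T -> R) :
  cpmetric D -> cpmetric D' -> cpmetric (fun x y => Num.max (D x y) (D' x y)).
Proof.
move=> [D0 Ds Dt D1 Dc] [D0' Ds' Dt' D1' Dc']; split.
- by move=> x; rewrite D0 D0' maxxx.
- by move=> x y; rewrite Ds Ds'.
- move=> x y z; rewrite ge_max; apply/andP; split.
    by apply: (le_trans (Dt x y z)); rewrite lerD// le_max lexx.
  by apply: (le_trans (Dt' x y z)); rewrite lerD// le_max lexx orbT.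
- by move=> x y; rewrite ge_max D1 D1'.
- move=> x e e0; near=> y; rewrite gt_max; apply/andP; split; near: y.
    exact: Dc.
  exact: Dc'.
Unshelve. all: by end_near. Qed.

Lemma cpmetric_min1 (T : topologicalType) (d : T -> T -> R) :
  (forall x, d x x = 0) -> (forall x y, d x y = d y x) ->
  (forall x y z, d x z <= d x y + d y z) ->
  (forall x e, 0 < e -> \forall y \near x, d x y < e) ->
  cpmetric (fun x y => Num.min 1 (d x y)).
Proof.
move=> d0 ds dt dc.
have dge0 x y : 0 <= d x y by have := dt x y x; rewrite d0 (ds y x); lra.
split.
- by move=> x; rewrite d0 minEle ler10.
- by move=> x y; rewrite ds.
- move=> x y z; have := dt x y z; have := dge0 x y; have := dge0 y z.
  by rewrite !minEle; case: ifP; case: ifP; case: ifP; rewrite ?leNgt; lra.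
- by move=> x y; rewrite ge_min lexx.
- move=> x e e0; near=> y; rewrite gt_min; apply/orP; right.
  by near: y; exact: dc.
Unshelve. all: by end_near. Qed.

Definition perfect_pm (T : topologicalType) (D : T -> T -> R) : Prop :=
  forall (x : T) (F : set_system T), UltraFilter F ->
    (forall e : R, 0 < e -> F [set y | D x y < e]) -> exists y : T, F --> y.

End Pseudometric.

Lemma continuous_pair (S T U : topologicalType) (f : S -> T) (g : S -> U) :
  continuous f -> continuous g -> continuous (fun x => (f x, g x)).
Proof. by move=> cf cg x; apply: cvg_pair; [exact: cf|exact: cg]. Qed.

Lemma continuous_comp_fun (S T U : topologicalType) (f : S -> T) (g : T -> U) :
  continuous f -> continuous g -> continuous (fun x => g (f x)).
Proof. by move=> cf cg x; apply: continuous_comp; [exact: cf|exact: cg]. Qed.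

Lemma fst_continuous (S T : topologicalType) : continuous (@fst S T).
Proof. by move=> x; exact: cvg_fst. Qed.

Lemma snd_continuous (S T : topologicalType) : continuous (@snd S T).
Proof. by move=> x; exact: cvg_snd. Qed.

Lemma fmap_ultra (T U : Type) (f : T -> U) (F : set_system T) :
  UltraFilter F -> UltraFilter (f @ F).
Proof.
move=> FU; split; first exact: fmap_proper_filter.
move=> G GF FG; rewrite eqEsubset; split => // A GA.
have [//|FnA] := in_ultra_setVsetC (f @^-1` A) FU.
have /FG GnA : (f @ F) (~` A) by [].
by have /filter_ex[? []] : G (A `&` ~` A) by exact: filterI.
Qed.

Lemma ultra_closed_cvg (T : topologicalType) (F : set_system T) (C : set T)
    (x : T) : ProperFilter F -> closed C -> F C -> F --> x -> C x.
Proof.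
move=> FF cC FC Fx; apply: cC => B xB.
exact: (@filter_ex _ F _ _ (filterI FC (Fx B xB))).
Qed.

(** * p-paracompact spaces in terms of perfect pseudometrics *)

Section PParacompact.
Context {R : realType}.

(** Used for indirect compactness arguments: when a statement fails at every scale, the
    counterexamples at each scale form a filter base, and an ultrafilter containing them has a limit
    that refutes the failure. *)
Lemma ultra_separated (T : Type) (I : Type) (P : set I) (B : I -> set T) :
  P !=set0 -> (forall i, P i -> B i !=set0) ->
  (forall i j, P i -> P j -> exists2 k, P k & B k `<=` B i `&` B j) ->
  exists F : set_system T, UltraFilter F /\ forall i, P i -> F (B i).
Proof.
move=> [i0 Pi0] B0 BI.
have PF : ProperFilter (filter_from P B).
  apply: filter_from_proper => //; apply: filter_from_filter;
    first by exists i0.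
  exact: BI.
have [F [FU sF]] := ultraFilterLemma PF.
by exists F; split=> // i Pi; apply: sF; exists i.
Qed.

Lemma perfect_pm_cvg (T : topologicalType) (D : T -> T -> R) (x : T)
    (F : set_system T) :
  cpmetric D -> perfect_pm D -> UltraFilter F ->
  (forall e : R, 0 < e -> F [set y | D x y < e]) ->
  exists2 y : T, F --> y & D x y = 0.
Proof.
move=> cD pD FU Fx; have [y Fy] := pD x F FU Fx; exists y => //.
have [D0 Ds Dt D1 Dc] := cD.
apply/eqP; rewrite eq_le cpmetric_ge0// andbT; apply/ler_addgt0Pl => e e0.
have e20 : 0 < e / 2 by lra.
have FI : F ([set z | D x z < e / 2] `&` [set z | D y z < e / 2]).
  by apply: filterI; [exact: Fx|exact: (Fy _ (Dc y _ e20))].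
have [z [/= xz yz]] := filter_ex FI.
by have := Dt x z y; rewrite (Ds z y); lra.
Qed.

(** In the quotient by zero distance this says that the image of C is closed. *)
Lemma perfect_pm_closed (T : topologicalType) (D : T -> T -> R) (x : T)
    (C : set T) :
  cpmetric D -> perfect_pm D -> closed C ->
  (forall e : R, 0 < e -> exists2 y, C y & D x y < e) ->
  exists2 y : T, C y & D x y = 0.
Proof.
move=> cD pD cC Cx.
have [|e e0|e e' e0 e0'|F [FU FB]] := @ultra_separated T R
    [set e | 0 < e] (fun e => C `&` [set y | D x y < e]).
- by exists 1 => /=.
- by have [y] := Cx e e0; exists y.
- exists (Num.min e e'); first by rewrite /= lt_min; apply/andP.
  by move=> y /= [Cy]; rewrite lt_min => /andP[].
have [|y Fy xy0] := perfect_pm_cvg (F := F) (x := x) cD pD FU.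
  by move=> e e0; apply: filterS (FB e e0) => y [].
exists y => //; apply: (ultra_closed_cvg _ cC _ Fy).
by apply: filterS (FB 1 ltr01) => z [].
Qed.

Section MetricQuotient.
Variables (T : topologicalType) (D : T -> T -> R) (cD : cpmetric D).

(* The hypothesis is a parameter so that the metric instance can be inferred. *)
Definition mquot_of (_ : cpmetric D) : Type := {u : T -> R | exists x, u = D x}.
Local Notation mquot := (mquot_of cD).
HB.instance Definition _ := gen_eqMixin mquot.
HB.instance Definition _ := gen_choiceMixin mquot.

Definition mrep (u : mquot) : T := projT1 (cid (projT2 u)).
(** Points at distance 0 have the same distance function, so the classes of the metric quotient can
    be realised as the functions [D x]. *)
Definition mproj (x : T) : mquot := exist _ (D x) (ex_intro _ x erefl).
Definition mdistq (u v : mquot) : R := D (mrep u) (mrep v).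

Lemma mrepE u : sval u = D (mrep u).
Proof. by rewrite /mrep; case: cid. Qed.

Lemma mdistqE x y : mdistq (mproj x) (mproj y) = D x y.
Proof.
have [D0 Ds _ _ _] := cD.
by rewrite /mdistq -mrepE /= Ds -mrepE /= Ds.
Qed.

Lemma mprojK u : mproj (mrep u) = u.
Proof.
have := mrepE u; case: u => u pu ue; apply: eq_exist => /=.
by rewrite -ue.
Qed.

Fact mdistqxx u : mdistq u u = 0.
Proof. by have [D0 _ _ _ _] := cD; exact: D0. Qed.
Fact mdistq_positivity u v : mdistq u v = 0 -> u = v.
Proof.
rewrite -(mprojK u) -(mprojK v) mdistqE; move: (mrep u) (mrep v) => x y xy.
apply: eq_exist; apply/funext => z; apply/eqP; rewrite -subr_eq0 -normr_eq0.
by rewrite eq_le normr_ge0 andbT -xy; exact: cpmetric_dist.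
Qed.
Fact mdistq_sym u v : mdistq u v = mdistq v u.
Proof. by have [_ Ds _ _ _] := cD; exact: Ds. Qed.
Fact mdistq_triangle v u w : mdistq u w <= mdistq u v + mdistq v w.
Proof. by have [_ _ Dt _ _] := cD; exact: Dt. Qed.

HB.instance Definition _ := isMetric.Build R mquot
  mdistqxx mdistq_positivity mdistq_sym mdistq_triangle.
End MetricQuotient.

Lemma perfect_pm_paracompact (T : topologicalType) (D : T -> T -> R) :
  hausdorff_space T -> cpmetric D -> perfect_pm D -> p_paracompact R T.
Proof.
move=> hT cD pD; split => //; have [D0 Ds Dt D1 Dc] := cD.
have ballq (u : mquot_of cD) e (x : T) :
    ball u e (mproj cD x) = (D (mrep u) x < e) :> Prop.
  by rewrite ballEmdist/= -(mdistqE cD) mprojK.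
exists (mquot_of cD), (mproj cD); split.
- move=> x; apply/cvg_ballP => e e0; near=> y.
  rewrite -[mproj cD x]mprojK mprojK ballq.
  rewrite Ds -(mdistqE cD) mprojK mdistqE Ds; near: y; exact: Dc.
- by move=> u; exists (mrep u); rewrite mprojK.
- move=> C cC u uC.
  have [e e0|y Cy uy] := perfect_pm_closed (x := mrep u) cD pD cC.
    have [_ [[y Cy <-]]] := uC _ (nbhsx_ballx u e e0).
    by rewrite ballq; exists y.
  exists y => //; apply: (@mdistq_positivity _ _ cD).
  by rewrite -[u]mprojK mdistqE Ds.
- move=> u; rewrite compact_ultra => F FU Fu.
  have [e e0|y Fy uy] := perfect_pm_cvg (F := F) (x := mrep u) cD pD FU.
    apply: filterS Fu => y /= <-.
    by rewrite -(mdistqE cD) mprojK mdistqE D0.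
  exists y; split => //=; apply: (@mdistq_positivity _ _ cD).
  by rewrite -[u]mprojK mdistqE Ds.
Unshelve. all: by end_near. Qed.

Lemma paracompact_perfect_pm (T : topologicalType) :
  p_paracompact R T ->
  hausdorff_space T /\ exists D : T -> T -> R, cpmetric D /\ perfect_pm D.
Proof.
move=> [hT [M [f [cf fs fcl fK]]]]; split=> //.
have cD : cpmetric (fun x y => Num.min 1 (mdist (f x) (f y))).
  apply: cpmetric_min1.
  - by move=> x; exact: mdistxx.
  - by move=> x y; exact: metric_sym.
  - by move=> x y z; exact: metric_triangle.
  - move=> x e e0.
    have : \forall y \near x, ball (f x) e (f y) by exact: (cvg_ball (cf x)).
    by apply: filterS => y; rewrite ballEmdist.
exists (fun x y => Num.min 1 (mdist (f x) (f y))); split => // x F FU Fx.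
pose A := f @^-1` [set f x].
(* Since f is closed, a closure missing the fibre A would keep f x away from the image of B,
   although f tends to f x along F. *)
have FclA B : F B -> closure B `&` A !=set0.
  move=> FB; apply: contrapT => BA0.
  have fxB : ~ (f @` closure B) (f x).
    by move=> [y By yx]; apply: BA0; exists y.
  have : nbhs (f x) (~` (f @` closure B)).
    apply: open_nbhs_nbhs; split => //; apply: closed_openC.
    by apply: fcl; exact: closed_closure.
  move=> /nbhs_ballP[e /= e0 xeB].
  have F1 : F [set y | Num.min 1 (mdist (f x) (f y)) < Num.min 1 e].
    by apply: Fx; rewrite lt_min ltr01.
  have [y [By /=]] := filter_ex (filterI FB F1).
  rewrite lt_min !gt_min ltxx /= => /andP[d1 de].
  apply: (xeB (f y)); last by exists y => //; exact: subset_closure.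
  rewrite ballEmdist/=; case/orP: de => // e1; exact: lt_trans d1 e1.
(* The traces of the closures on the compact fibre have a cluster point p. An open neighbourhood of
   p meets each closure, hence each member of F, so the ultrafilter F converges to p. *)
have PG : ProperFilter (filter_from F (fun B => closure B `&` A)).
  apply: filter_from_proper => //; apply: filter_from_filter.
    by exists setT; exact: filterT.
  move=> B C FB FC; exists (B `&` C); first exact: filterI.
  by move=> y [/closureI[? ?] ?].
have [|p [_ pG]] := fK (f x) _ PG.
  by exists setT; [exact: filterT|move=> y []].
exists p; have : cluster F p; last by rewrite ultra_cvg_clusterE.
move=> B C FB; rewrite nbhsE => -[C' [oC' C'p] C'C].
have [y [[By _] C'y]] : (closure B `&` A) `&` C' !=set0.
  by apply: pG; [exists B|exact: open_nbhs_nbhs].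
have [z [Bz C'z]] := By C' (open_nbhs_nbhs (conj oC' C'y)).
by exists z; split=> //; exact: C'C.
Qed.

(** The limit in U lies in the closed image of the closure of every member of F; injectivity makes
    these preimages one point, which is a cluster point of F. *)
Lemma perfect_pm_closed_embedding (T U : topologicalType) (i : T -> U)
    (D : U -> U -> R) :
  closed_embedding i -> cpmetric D -> perfect_pm D ->
  perfect_pm (fun x y => D (i x) (i y)).
Proof.
move=> [ci ii icl] cD pD x F FU Fx.
have iFU := fmap_ultra i FU.
have [y Fy] := pD (i x) _ iFU Fx.
have clF B : F B -> (i @` closure B) y.
  move=> FB; have FiB : F (i @^-1` (i @` closure B)).
    by apply: filterS FB => z Bz; exists z => //; exact: subset_closure.
  exact: (ultra_closed_cvg _ (icl _ (@closed_closure _ B)) FiB Fy).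
have [z _ zy] := clF setT filterT.
exists z; have : cluster F z; last by rewrite ultra_cvg_clusterE.
move=> B C FB zC; have [w Bw wy] := clF B FB.
have wz : w = z by apply: ii; rewrite wy.
by rewrite wz in Bw; exact: Bw.
Qed.

Lemma perfect_pm_prod (T U : topologicalType) (D : T -> T -> R)
    (D' : U -> U -> R) :
  perfect_pm D -> perfect_pm D' ->
  perfect_pm (fun x y : T * U => Num.max (D x.1 y.1) (D' x.2 y.2)).
Proof.
move=> pD pD' x F FU Fx.
have [e e0|y1 Fy1] := pD x.1 _ (fmap_ultra fst FU).
  suff : F [set y | D x.1 y.1 < e] by [].
  by apply: filterS (Fx e e0) => y /=; rewrite gt_max => /andP[].
have [e e0|y2 Fy2] := pD' x.2 _ (fmap_ultra snd FU).
  suff : F [set y | D' x.2 y.2 < e] by [].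
  by apply: filterS (Fx e e0) => y /=; rewrite gt_max => /andP[].
exists (y1, y2) => A [[A1 A2] [/= yA1 yA2] sA].
have F1 : F (fst @^-1` A1) := Fy1 _ yA1.
have F2 : F (snd @^-1` A2) := Fy2 _ yA2.
by apply: filterS (filterI F1 F2) => -[u v] [/= ? ?]; exact: sA.
Qed.

Lemma perfect_pm_compact (T : topologicalType) :
  compact [set: T] -> perfect_pm (fun _ _ : T => 0 : R).
Proof.
rewrite compact_ultra => cT x F FU _.
by have [y [_ Fy]] := cT F FU filterT; exists y.
Qed.

Lemma perfect_pm_le (T : topologicalType) (D D' : T -> T -> R) :
  (forall x y, D x y <= D' x y) -> perfect_pm D -> perfect_pm D'.
Proof.
move=> DD' pD x F FU Fx; apply: (pD x) => e e0.
by apply: filterS (Fx e e0) => y /=; exact: le_lt_trans.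
Qed.

End PParacompact.

(** * Neighbourhoods of the diagonal *)

Definition diag_nbhs (T : topologicalType) (E : T -> T -> Prop) : Prop :=
  forall x : T, exists2 Q, nbhs x Q & forall y z, Q y -> Q z -> E y z.

Lemma diag_nbhs_refl (T : topologicalType) (E : T -> T -> Prop) x :
  diag_nbhs E -> E x x.
Proof. by move=> /(_ x)[Q xQ QE]; apply: QE; exact: nbhs_singleton. Qed.

Lemma diag_nbhsI (T : topologicalType) (E E' : T -> T -> Prop) :
  diag_nbhs E -> diag_nbhs E' -> diag_nbhs (fun x y => E x y /\ E' x y).
Proof.
move=> dE dE' x; have [Q xQ QE] := dE x; have [Q' xQ' QE'] := dE' x.
exists (Q `&` Q'); first exact: filterI.
by move=> y z [? ?] [? ?]; split; [exact: QE|exact: QE'].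
Qed.

Lemma max0_lipschitz (R : realType) (a b e : R) :
  `|a - b| <= e -> `|Num.max 0 a - Num.max 0 b| <= e.
Proof.
by rewrite !ler_norml !maxEle; case: ifP; case: ifP; rewrite ?leNgt; lra.
Qed.

Lemma well_founded_total (T : eqType) : exists lt : T -> T -> Prop,
  (forall x y, x <> y -> lt x y \/ lt y x) /\
  forall A : set T, A !=set0 -> exists2 x, A x & forall z, A z -> ~ lt z x.
Proof.
have [W Wwo] := well_ordering_principle T.
have Wrefl x : W x x.
  have [|z [[+ zx] _]] := Wwo (pred1 x); first by exists x; rewrite inE.
  by rewrite inE => /eqP zx'; rewrite -{1}zx'; apply: zx; rewrite inE.
exists (fun z x => ~~ W x z); split=> [x y xy|A [a Aa]].
  apply/orP; rewrite -negb_and; apply/negP => /andP[yx xy'].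
  have [|z [_ zu]] := Wwo (pred2 x y); first by exists x; rewrite !inE eqxx.
  apply: xy; transitivity z; [symmetry|]; apply: zu; split;
    rewrite ?inE ?eqxx ?orbT// => t; by rewrite !inE => /orP[]/eqP->.
have [|z [[Az zA] _]] := Wwo [pred x | `[<A x>]].
  by exists a; exact/asboolP.
exists z; first exact/asboolP.
by move=> t At; rewrite zA//; exact/asboolP.
Qed.

Section Refinement.
Context {R : realType} (T : topologicalType) (D : T -> T -> R).
Hypothesis hT : hausdorff_space T.
Hypothesis cD : cpmetric D.
Hypothesis pD : perfect_pm D.

(** Otherwise an ultrafilter on the complement of U contains the closure of every neighbourhood of x
    and all balls around x. Perfectness gives it a limit, and the Hausdorff property identifies this
    limit with x. *)
Lemma perfect_pm_regular (x : T) (U : set T) :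
  nbhs x U -> exists2 V : set T, nbhs x V & closure V `<=` U.
Proof.
move=> xU; apply: contrapT => H; have [D0 Ds Dt D1 Dc] := cD.
have [||[V e] [V' e'] [/= xV e0] [xV' e'0]|F [FU FB]] := @ultra_separated T
  (set T * R)
    [set p | nbhs x p.1 /\ 0 < p.2]
    (fun p => closure p.1 `&` ~` U `&` [set y | D x y < p.2]).
- by exists (setT, 1); split; [exact: filterT|exact: ltr01].
- move=> [V e] [/= xV e0]; apply: contrapT => VU; apply: H.
  have e20 : 0 < e / 2 by lra.
  exists (V `&` [set y | D x y < e / 2]).
    by apply: filterI => //; exact: Dc.
  move=> y Vy; apply: contrapT => nUy; apply: VU; exists y; split;
    first split => //.
    by have [] := closureI Vy.
  have [z [[_ /= xz] /= yz]] := Vy _ (Dc y _ e20).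
  by have := Dt x z y; rewrite /= (Ds z y); lra.
- exists (V `&` V', Num.min e e') => /=.
    by split; [exact: filterI|rewrite lt_min e0].
  by move=> y [[/closureI[? ?] ?]]; rewrite /= lt_min => /andP[? ?].
have [|y Fy] := pD (x := x) FU.
  move=> e e0; have := FB (setT, e); rewrite /= => FBe.
  by apply: filterS (FBe _) => [z []|]; last by split=> //; exact: filterT.
have FnU : F (~` U).
  have := FB (setT, 1); rewrite /= => FBe.
  by apply: filterS (FBe _) => [z [[]]|]; last by split=> //; exact: filterT.
have xy : x = y.
  apply: hT => A B xA yB.
  have FA : F (closure A).
    have := FB (A, 1); rewrite /= => FBe.
    by apply: filterS (FBe _) => [z [[]]|].
  have FBi : F B° by apply: Fy; exact: nbhs_interior.
  have [z [zA zB]] := filter_ex (filterI FA FBi).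
  have [w [Aw Bw]] := zA _ (open_nbhs_nbhs (conj (@open_interior _ B) zB)).
  by exists w; split => //; exact: interior_subset.
rewrite -xy in Fy.
have FUU : F U by exact: Fy.
by have [z []] := filter_ex (filterI FUU FnU).
Qed.

(** If no pair of E' and r works, there is an ultrafilter of bad triples (a, b, y) lying in every E'
    and with D x y tending to 0. Perfectness makes y converge, and one suitable E' built at the
    limit is contradictory. *)
Lemma refine_local (E : T -> T -> Prop) (x : T) : diag_nbhs E ->
  exists E' : T -> T -> Prop, diag_nbhs E' /\ exists r : R, 0 < r <= 1 /\
    forall y a b, D x y < r -> E' a y -> E' y b -> E a b.
Proof.
move=> dE; apply: contrapT => H; have [D0 Ds Dt D1 Dc] := cD.
have [||[E1 e] [E2 e'] [/= dE1 e0] [dE2 e'0]|F [FU FB]] :=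
  @ultra_separated (T * T * T) ((T -> T -> Prop) * R)
    [set p | diag_nbhs p.1 /\ 0 < p.2 <= 1]
    (fun p => [set t | [/\ D x t.2 < p.2, p.1 t.1.1 t.2, p.1 t.2 t.1.2 &
                        ~ E t.1.1 t.1.2]]).
- exists (fun _ _ => True, 1); split; last by rewrite /= ltr01 lexx.
  by move=> y; exists setT => //; exact: filterT.
- move=> [E1 e] [/= dE1 e0]; apply: contrapT => n0; apply: H.
  exists E1; split => //; exists e; split=> // y a b xy ay yb.
  by apply: contrapT => nab; apply: n0; exists (a, b, y).
- exists (fun y z => E1 y z /\ E2 y z, Num.min e e') => /=.
    split; first exact: diag_nbhsI.
    by move: e0 e'0 => /andP[a b] /andP[c d]; rewrite lt_min ge_min a c b.
  by move=> y /= [+ [? ?] [? ?] ?]; rewrite lt_min => /andP[? ?].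
have d_true : diag_nbhs (fun _ _ : T => True).
  by move=> y; exists setT => //; exact: filterT.
have [|y Fy] := pD (x := x) (fmap_ultra snd FU).
  move=> e e0; suff : F [set t | D x t.2 < e] by [].
  have := FB (fun _ _ => True, Num.min e 1); rewrite /= => FBe.
  apply: filterS (FBe _) => [z [+ _ _ _]|]; first by rewrite lt_min => /andP[].
  by split=> //; rewrite lt_min ge_min e0 ltr01 lexx orbT.
have [Q yQ QE] := dE y.
have [V yV VQ] := perfect_pm_regular (nbhs_interior yQ).
(* A point related to a point of the closure of V must lie in Q. As y is eventually in V, both a and
   b fall into Q, where E holds. *)
pose E' a b := (closure V a -> Q b) /\ (closure V b -> Q a).
have dE' : diag_nbhs E'.
  move=> z; have [zV|zV] := pselect (closure V z).
    exists Q°; first by apply: nbhs_interior; exact: VQ.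
    by move=> a b Qa Qb; split=> _; exact: interior_subset.
  exists (~` closure V); last by move=> a b aV bV; split.
  by apply: open_nbhs_nbhs; split => //; exact/closed_openC/closed_closure.
have F1 : F [set t | V t.2] by exact: Fy.
have F2 := FB (E', 1) (conj dE' _).
have [|t [/= Vt [_ [_ h1] [h2 _] nE]]] := filter_ex (filterI F1 (F2 _)).
  by rewrite /= ltr01 lexx.
by apply: nE; apply: QE; [apply: h1|apply: h2]; exact: subset_closure.
Qed.

(* In a well-ordering of T, [sigma x] measures by how much the ball around x
   exceeds all earlier ones; sup sigma is positive and locally only finitely
   many x have sigma x > (sup sigma) / 2, which makes a locally finite choice of
   the local refinements possible. *)
Lemma refine_diag_nbhs (E : T -> T -> Prop) : diag_nbhs E ->
  exists E' : T -> T -> Prop, diag_nbhs E' /\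
    forall a y b, E' a y -> E' y b -> E a b.
Proof.
move=> dE; have [D0 Ds Dt D1 Dc] := cD.
have [E1r E1P] := choice (fun x => refine_local x dE).
have [dE1 {}E1P] := all_and2 E1P; have [r {}E1P] := choice E1P.
have [r01 {}E1P] := all_and2 E1P.
have [lt [lt_total lt_min]] := well_founded_total T.
pose mu x y := Num.max 0 (r x - D x y).
pose below x y := supr (fun z => if `[<lt z x>] then mu z y else 0).
pose sigma x y := Num.max 0 (mu x y - below x y).
pose S y := supr (sigma ^~ y).
have mu01 x y : 0 <= mu x y <= 1.
  have := r01 x; have := cpmetric_ge0 x y cD.
  by rewrite /mu maxEle; case: ifP; lra.
have bmu01 x y z : 0 <= (if `[<lt z x>] then mu z y else 0) <= 1.
  by case: ifP => _ //; rewrite lexx ler01.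
have below01 x y : 0 <= below x y <= 1 by exact: supr_in01.
have sigma01 x y : 0 <= sigma x y <= 1.
  have := mu01 x y; have := below01 x y.
  by rewrite /sigma maxEle; case: ifP; lra.
have S01 y : 0 <= S y <= 1 by exact: supr_in01.
have mu_lip x y z : `|mu x y - mu x z| <= D y z.
  apply: max0_lipschitz; have := cpmetric_dist z y x cD.
  by rewrite (Ds z x) (Ds y x) (Ds z y) !ler_norml; lra.
have below_lip x y z : `|below x y - below x z| <= D y z.
  apply: supr_dist => //; first exact: cpmetric_ge0.
  by move=> t; case: ifP => // _; rewrite subrr normr0 cpmetric_ge0.
have sigma_lip x y z : `|sigma x y - sigma x z| <= 2 * D y z.
  apply: max0_lipschitz; have := mu_lip x y z; have := below_lip x y z.
  by rewrite !ler_norml; lra.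
have S_lip y z : `|S y - S z| <= 2 * D y z.
  by apply: supr_dist => //; have := cpmetric_ge0 y z cD; lra.
(* For the first x whose ball contains y nothing is subtracted, so [sigma x y] equals [mu x y]. *)
have S_gt0 y : 0 < S y.
  have [|x /= mux xmin] := lt_min [set x | 0 < mu x y].
    exists y => /=; rewrite /mu D0 subr0 lt_max; have := r01 y.
    by move=> /andP[-> _]; rewrite orbT.
  apply: (lt_le_trans mux); apply: (@le_trans _ _ (sigma x y)); last first.
    apply: (@supr_ub _ _ (sigma ^~ y) x) => j.
    by have /andP[] := sigma01 j y.
  rewrite /sigma; suff -> : below x y = 0 by rewrite subr0 le_max lexx orbT.
  apply/eqP; rewrite eq_le; have /andP[-> _] := below01 x y; rewrite andbT.
  apply: supr_le => // z; case: ifP => // /asboolP zx.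
  by rewrite leNgt; apply/negP => /xmin.
pose rel x y := S y < 2 * sigma x y.
have relP y : exists x, rel x y.
  have [||//|x xy] := @supr_gt _ _ (sigma ^~ y) (S y / 2).
  - by move=> j; have /andP[] := sigma01 j y.
  - by have := S_gt0 y; lra.
  - by have := S_gt0 y; rewrite -/(S y); lra.
  by exists x; rewrite /rel; lra.
have rel_near x y : rel x y -> D x y < r x.
  rewrite /rel => xy; have Sy := S_gt0 y.
  have : 0 < sigma x y by lra.
  rewrite /sigma lt_max ltxx /= => h.
  have : 0 < mu x y by have := below01 x y; lra.
  by rewrite /mu lt_max ltxx /=; lra.
(* The local refinement at x is imposed on a pair whenever x is relevant at one of its ends. In a
   chain a, y, b any x relevant at y then applies to both pairs. *)
exists (fun a b => forall x, rel x a \/ rel x b -> E1r x a b); split;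
  last first.
  move=> a y b ay yb; have [x xy] := relP y.
  apply: (E1P x y a b (rel_near _ _ xy)); [apply: ay|apply: yb]; tauto.
(* Within distance c of y0 both S and sigma vary by at most 2 c. If x is relevant at such a point,
   where S is at least 14 c, then sigma exceeds 7 c there and hence 4 c at y0. *)
move=> y0; set c := S y0 / 16.
have c0 : 0 < c by rewrite divr_gt0.
(* Of two indices with sigma above 4 c at y0, the later one has mu larger by more than 4 c. Hence
   each interval of length 4 c contains mu for at most one of them, and finitely many intervals
   cover [0, 1]. *)
pose bin x := Num.truncn (mu x y0 / (4 * c)).
have c40 : 0 < 4 * c by lra.
have binP x : (bin x)%:R * (4 * c) <= mu x y0 < (bin x)%:R * (4 * c) + 4 * c.
  have m0 : 0 <= mu x y0 / (4 * c).
    by rewrite divr_ge0 ?(ltW c40)//; have /andP[] := mu01 x y0.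
  have := truncn_itv m0; rewrite -/(bin x) ler_pdivlMr// ltr_pdivrMr//.
  by move=> /andP[h1 h2]; apply/andP; split=> //; rewrite -natr1 mulrDl mul1r
    in h2.
have sigma_jump x x' : 4 * c < sigma x' y0 -> lt x x' ->
    mu x y0 + 4 * c < mu x' y0.
  rewrite /sigma lt_max => /orP[|h xx']; first lra.
  have : mu x y0 <= below x' y0.
    have := @supr_ub _ _ (fun z => if `[<lt z x'>] then mu z y0 else 0) x.
    by rewrite asboolT//; apply=> j; have /andP[] := bmu01 x' y0 j.
  by lra.
have bin_inj x x' : 4 * c < sigma x y0 -> 4 * c < sigma x' y0 ->
    bin x = bin x' -> x = x'.
  move=> sx sx' xx'; apply: contrapT => /lt_total[h|h].
    by have := sigma_jump _ _ sx' h; have := binP x; have := binP x';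
      rewrite xx'; lra.
  by have := sigma_jump _ _ sx h; have := binP x; have := binP x'; rewrite xx';
    lra.
have /choice[Q QP] : forall n : nat, exists Q : set T, nbhs y0 Q /\
    forall x, 4 * c < sigma x y0 -> bin x = n ->
    forall a b, Q a -> Q b -> E1r x a b.
  move=> n.
  have [[x [sx xn]]|H] := pselect (exists x, 4 * c < sigma x y0 /\ bin x = n).
    have [Q yQ QE] := dE1 x y0; exists Q; split=> // x' sx' x'n.
    by rewrite (bin_inj x' x)// x'n.
  exists setT; split; first exact: filterT.
  by move=> x sx xn; exfalso; apply: H; exists x.
pose N := (Num.truncn (4 * c)^-1).+1.
have binN x : (bin x < N)%N.
  rewrite ltnS; apply: le_truncn; rewrite ler_pdivrMr// mulVf ?gt_eqF//.
  by have /andP[] := mu01 x y0.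
have QN n : nbhs y0 [set y | forall m, (m < n)%N -> Q m y].
  elim: n => [|n IH]; first by apply: nearW.
  apply: filterS (filterI IH (QP n).1) => y [Qy Qny] m.
  by rewrite ltnS leq_eqVlt => /orP[/eqP->//|]; exact: Qy.
exists ([set y | D y0 y < c] `&` [set y | forall m, (m < N)%N -> Q m y]).
  by apply: filterI => //; exact: Dc.
have relc x a : D y0 a < c -> rel x a -> 4 * c < sigma x y0.
  rewrite /rel => ac sa; have := S_lip y0 a; have := sigma_lip x y0 a.
  have -> : S y0 = 16 * c by rewrite /c mulrC divfK ?gt_eqF.
  by rewrite !ler_norml; lra.
move=> a b [/= ac Qa] [/= bc Qb] x xab.
apply: ((QP (bin x)).2 x _ erefl); [|exact: Qa|exact: Qb].
by case: xab; exact: relc.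
Qed.

End Refinement.

Lemma expr2V_lt (R : realType) (e : R) : 0 < e -> exists n, 2^-1 ^+ n < e.
Proof.
move=> e0; pose n := (Num.truncn e^-1).+1; exists n.
have en : e^-1 < n%:R.
  by have := @truncn_itv R e^-1; rewrite invr_ge0 ltW// => /(_ isT)/andP[].
rewrite exprVn -[ltRHS]invrK ltf_pV2 ?posrE ?invr_gt0 ?exprn_gt0//.
by apply: (lt_le_trans en); rewrite -natrX ler_nat ltnW// ltn_expl.
Qed.

(** * Metrization of a sequence of diagonal neighbourhoods *)

Section Metrization.
Context {R : realType} (T : topologicalType).
Variable U : nat -> T -> T -> Prop.
Hypothesis U0 : forall x y, U 0 x y.
Hypothesis Udiag : forall n, diag_nbhs (U n).
Hypothesis Ucomp : forall n x y z, U n.+1 x y -> U n.+1 y z -> U n x z.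

Local Notation q n := ((2^-1 : R) ^+ n).

(* [dyadic n j z x] says that x is reached from z through a composition of the
   relations [U m] prescribed by the binary expansion of j / 2 ^ n, as in the
   proof of Urysohn's lemma. *)
Fixpoint dyadic n j z x : Prop :=
  if n is n'.+1 then
    if odd j then exists y, dyadic n' j./2 z y /\ U n'.+1 y x
    else dyadic n' j./2 z x
  else j = 0%N -> z = x.

Lemma dyadic0 n z x : dyadic n 0 z x -> z = x.
Proof. by elim: n => [/(_ erefl)|n IH]. Qed.

Lemma U_mono n x y : U n.+1 x y -> U n x y.
Proof.
by move=> xy; apply: Ucomp xy _; exact: diag_nbhs_refl (Udiag _).
Qed.

(** Binary addition with carry: when j is odd, its last step and the new one compose to a single
    step of the preceding level. *)
Lemma dyadicS n j z y x : dyadic n j z y -> U n y x -> dyadic n j.+1 z x.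
Proof.
elim: n j y x => [|n IH] j y x //=.
have [jo|je] := boolP (odd j).
  move=> [t [zt ty]] yx; rewrite -[X in dyadic _ X]/(uphalf j) uphalf_half jo.
  by rewrite add1n; apply: IH zt _; exact: Ucomp ty yx.
move=> zy yx; exists y; split => //.
by rewrite -[X in dyadic _ X]/(uphalf j) uphalf_half (negbTE je).
Qed.

Lemma dyadic_coarse n j z x : dyadic n.+1 j z x -> dyadic n (uphalf j) z x.
Proof.
rewrite /= uphalf_half; case: ifP => _; rewrite ?add0n// add1n.
by move=> [y [zy yx]]; apply: dyadicS zy _; exact: U_mono.
Qed.

(** Each halving rounds the numerator up and adds at most one unit of the finer level; these errors
    sum to [q n - q (m + n)]. *)
Lemma dyadic_coarsen n m j z x : dyadic (m + n) j z x ->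
  exists2 j', dyadic n j' z x &
    j'%:R * q n <= j%:R * q (m + n) + q n - q (m + n).
Proof.
elim: m j => [|m IH] j; first by exists j => //; rewrite add0n; lra.
rewrite addSn => /dyadic_coarse /IH [j' zx j'j]; exists j' => //.
apply: (le_trans j'j); rewrite exprS.
have h : (uphalf j)%:R * 2 <= (j%:R + 1 : R).
  rewrite -natrM natr1 ler_nat muln2 -[X in (_ <= X.+1)%N]odd_double_half.
  by rewrite uphalf_half doubleD; case: (odd j).
have q0 : 0 <= q (m + n) by rewrite exprn_ge0// invr_ge0.
have := ler_wpM2r q0 h; lra.
Qed.

Lemma dyadic_refine n m j z x : dyadic n j z x ->
  exists2 j', dyadic (m + n) j' z x & j'%:R * q (m + n) = j%:R * q n.
Proof.
elim: m => [|m IH]; first by exists j.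
move=> /IH[j' zx j'j]; exists j'.*2; first by rewrite /= odd_double doubleK.
by rewrite addSn -j'j exprS -muln2 natrM -mulrA mulVKf// pnatr_eq0.
Qed.

Lemma dyadic_level n m j z x : dyadic m j z x ->
  exists2 j', dyadic n j' z x & j'%:R * q n <= j%:R * q m + q n.
Proof.
move=> mj; have q0 k : 0 <= q k by rewrite exprn_ge0// invr_ge0.
have [nm|/ltnW mn] := leqP n m.
  have := @dyadic_coarsen n (m - n) j z x; rewrite subnK// => /(_ mj)[j' zx h].
  by exists j' => //; have := q0 m; lra.
have [j' zx h] := dyadic_refine (n - m) mj; rewrite subnK// in zx h.
by exists j' => //; have := q0 n; lra.
Qed.

(** This is 1 minus the infimum of the dyadic times j / 2 ^ n in which x is reached from z, cut off
    at 0. *)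
Definition urysohn_fun z x : R :=
  supr (fun p => if `[<dyadic p.1 p.2 z x>] then Num.max 0 (1 - p.2%:R * q p.1)
    else 0).
Let term01 z x (p : nat * nat) :
  0 <= (if `[<dyadic p.1 p.2 z x>] then Num.max 0 (1 - p.2%:R * q p.1) else 0)
    <= 1.
Proof.
case: ifP => _; last by rewrite lexx ler01.
rewrite le_max lexx/= ge_max ler01/= lerBlDr lerDl mulr_ge0//.
by rewrite exprn_ge0// invr_ge0.
Qed.

Lemma urysohn_fun01 z x : 0 <= urysohn_fun z x <= 1.
Proof. by apply: supr_in01 => p; exact: term01. Qed.

Lemma urysohn_fun_refl z : urysohn_fun z z = 1.
Proof.
apply/eqP; rewrite eq_le; have /andP[_ ->] := urysohn_fun01 z z.
have := @supr_ub _ _ (fun p => if `[<dyadic p.1 p.2 z z>] then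
  Num.max 0 (1 - p.2%:R * q p.1) else 0) (0, 0)%N.
rewrite /= asboolT// mul0r subr0 maxEle ler01; apply=> p.
by have /andP[] := term01 z z p.
Qed.

(** One [q n] pays for rounding the chain to level n, the other for the additional step. *)
Lemma urysohn_fun_step n z x y : U n x y ->
  urysohn_fun z x <= urysohn_fun z y + 2 * q n.
Proof.
move=> xy; have q0 : 0 <= q n by rewrite exprn_ge0// invr_ge0.
apply: supr_le.
  by have := urysohn_fun01 z y; lra.
move=> [m j] /=; case: ifP => [/asboolP zx|_]; last by have :=
  urysohn_fun01 z y; lra.
have [j' zx' j'j] := dyadic_level n zx.
have zy := dyadicS zx' xy.
have := @supr_ub _ _ (fun p => if `[<dyadic p.1 p.2 z y>] then
  Num.max 0 (1 - p.2%:R * q p.1) else 0) (n, j'.+1).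
rewrite /= asboolT// -/(urysohn_fun z y) => /(_ _)h.
have {h} : Num.max 0 (1 - j'.+1%:R * q n) <= urysohn_fun z y.
  by apply: h => p; have /andP[] := term01 z y p.
rewrite ge_max -(natr1 j') => /andP[h0 h1]; rewrite ge_max; apply/andP; split;
  lra.
Qed.

Definition chain_metric x y : R :=
  supr (fun z => `|urysohn_fun z x - urysohn_fun z y|).

Let dist01 x y z : 0 <= `|urysohn_fun z x - urysohn_fun z y| <= 1.
Proof.
rewrite normr_ge0 ler_norml; have := urysohn_fun01 z x.
by have := urysohn_fun01 z y; lra.
Qed.

(** The supremum at z = x shows that y is reached from x in time less than [q n]. At level n the
    rounded time is below [2 * q n], so the numerator is 0 or 1: no step, or one step of [U n]. *)
Lemma chain_metric_lt n x y : chain_metric x y < q n -> U n x y.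
Proof.
move=> xy; have q0 k : 0 < q k by rewrite exprn_gt0 ?invr_gt0 ?ltr0n.
have h : 1 - q n < urysohn_fun x y.
  have := @supr_ub _ _ (fun z => `|urysohn_fun z x - urysohn_fun z y|) x.
  have d1 z : `|urysohn_fun z x - urysohn_fun z y| <= 1 by have /andP[] :=
    dist01 x y z.
  by move=> /(_ d1); rewrite -/(chain_metric x y) urysohn_fun_refl ler_norml;
    lra.
have q1 : q n <= 1 by rewrite exprn_ile1 ?invr_ge0 ?invf_le1 ?ler1n ?ltr0n.
have [||[m j] /=] := supr_gt _ _ h.
- by move=> p; have /andP[] := term01 x y p.
- by rewrite subr_ge0.
case: ifP => [/asboolP zx|_]; last by lra.
rewrite lt_max => /orP[|jm]; first by lra.
have {}jm : j%:R * q m < q n by lra.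
have small j' : j'%:R * q n < 2 * q n -> dyadic n j' x y -> U n x y.
  rewrite ltr_pM2r// ltr_nat; case: j' => [_ /dyadic0<-|[_|//]].
    exact: diag_nbhs_refl.
  by case: n {h xy q1 jm} => [_|n /= [z [/dyadic0<-]]].
have [nm|mn] := leqP n m.
  have := @dyadic_coarsen n (m - n) j x y;
    rewrite subnK// => /(_ zx)[j' zx' j'j].
  by apply: small zx'; have := q0 m; lra.
have [j' zx' j'j] := dyadic_refine (n - m) zx; rewrite subnK ?(ltnW mn)// in zx'
  j'j.
by apply: small zx'; have := q0 n; lra.
Qed.

Lemma chain_metric_le n x y : U n x y -> U n y x ->
  chain_metric x y <= 2 * q n.
Proof.
move=> xy yx; have q0 : 0 <= q n by rewrite exprn_ge0// invr_ge0.
apply: supr_le; first by lra.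
move=> z; have := urysohn_fun_step z xy; have := urysohn_fun_step z yx.
by rewrite ler_norml; lra.
Qed.

Lemma chain_cpmetric : cpmetric chain_metric.
Proof.
split.
- move=> x; apply/eqP; rewrite eq_le; apply/andP; split.
    by apply: supr_le => // z; rewrite subrr normr0.
  exact: supr_ge0.
- by move=> x y; congr supr; apply/funext => z; rewrite distrC.
- move=> x y z; apply: supr_leD => //; first exact: supr_ge0.
  move=> t; apply: (le_trans (ler_distD (urysohn_fun t y) _ _)); rewrite lerD2l.
  by apply: (@supr_ub _ _ (fun t => `|_ t y - _ t z|) t) => j; have /andP[] :=
    dist01 y z j.
- by move=> x y; apply: supr_le1 => z; have /andP[] := dist01 x y z.
- move=> x e e0; have [n qe] := expr2V_lt (divr_gt0 e0 (@ltr0Sn R 1)).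
  have {}qe : 2 * q n < e by move: qe; rewrite ltr_pdivlMr// mulrC.
  have [Q xQ QU] := Udiag n x.
  apply: filterS (xQ) => y Qy; apply: le_lt_trans qe.
  by apply: chain_metric_le; apply: QU => //; exact: nbhs_singleton.
Qed.

End Metrization.

(** * Pseudometrics dominating equicontinuous families *)

Section Domination.
Context {R : realType} (T : topologicalType).
Hypothesis pT : p_paracompact R T.

Lemma diag_nbhs_cpmetric (E : nat -> T -> T -> Prop) :
  (forall n, diag_nbhs (E n)) ->
  exists D : T -> T -> R, cpmetric D /\
    forall n x y, D x y < 2^-1 ^+ n.+1 -> E n x y.
Proof.
move=> dE; have [hT [d [cd pd]]] := paracompact_perfect_pm pT.
have /choice[ref refP] : forall E : T -> T -> Prop, exists E' : T -> T -> Prop,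
    diag_nbhs E -> diag_nbhs E' /\ forall a y b, E' a y -> E' y b -> E a b.
  move=> E1; have [dE1|nE1] := pselect (diag_nbhs E1); last by exists E1.
  by have [E' E'P] := refine_diag_nbhs hT cd pd dE1; exists E'.
(* The relation [E m] is refined together with [U m], so level m + 1 composed with the diagonal
   gives [E m]; this accounts for the exponent n + 1 in the conclusion. *)
pose U := fix U n : T -> T -> Prop :=
  if n is m.+1 then ref (fun x y => U m x y /\ E m x y) else fun _ _ => True.
have dU n : diag_nbhs (U n).
  elim: n => [|n IH] /=; last by have [] := refP _ (diag_nbhsI IH (dE n)).
  by move=> x; exists setT => //; exact: filterT.
have UP n x y z : U n.+1 x y -> U n.+1 y z -> U n x z /\ E n x z.
  by have [_] := refP _ (diag_nbhsI (dU n) (dE n)); exact.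
have Uc n x y z : U n.+1 x y -> U n.+1 y z -> U n x z by move=> a /(UP _ _ _ _
  a)[].
exists (chain_metric U); split; first exact: chain_cpmetric.
move=> n x y /chain_metric_lt xy.
have Uxy : U n.+1 x y by exact: xy.
by have [] := UP _ _ _ _ Uxy (diag_nbhs_refl y (dU n.+1)).
Qed.

Lemma cpmetric_dominating (B : topologicalType) (j : B -> T) (M : Type)
    (f : M -> B -> R) :
  closed_embedding j -> (forall m b, 0 <= f m b <= 1) ->
  (forall b e, 0 < e -> \forall b' \near b, forall m, `|f m b - f m b'| <= e) ->
  exists D : T -> T -> R, cpmetric D /\
    forall m b b', `|f m b - f m b'| <= D (j b) (j b').
Proof.
move=> [cj ij jcl] f01 fc.
pose E n x y := forall b b', j b = x -> j b' = y ->
  forall m, `|f m b - f m b'| <= 2^-1 ^+ n.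
have dE n : diag_nbhs (E n).
  move=> x; have [[b bx]|nx] := pselect (exists b, j b = x); last first.
    exists (~` range j).
      apply: open_nbhs_nbhs; split; last by move=> [b _ bx]; apply: nx;
        exists b.
      by apply: closed_openC; apply: jcl; exact: closedT.
    by move=> y z ny _ b b' jb; exfalso; apply: ny; exists b.
  have e0 : 0 < (2^-1 ^+ n / 2 : R) by rewrite divr_gt0// exprn_gt0// invr_gt0.
  have [O [oO Ob] OP] : exists2 O, open_nbhs b O & O `<=`
      [set b' | forall m, `|f m b - f m b'| <= 2^-1 ^+ n / 2].
    have h : nbhs b [set b' | forall m, `|f m b - f m b'| <= 2^-1 ^+ n / 2] :=
      fc b _ e0.
    by rewrite nbhsE in h.
  (* Open because j is closed; its trace on B lies in O, and off the image of j the relation is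
     vacuous. *)
  exists (~` (j @` ~` O)).
    apply: open_nbhs_nbhs; split; first by apply/closed_openC/jcl;
      exact: open_closedC.
    by move=> [c nOc]; rewrite -bx => /ij cb; apply: nOc; rewrite cb.
  have inO y c : (~` (j @` ~` O)) y -> j c = y -> O c.
    by move=> ny cy; apply: contrapT => nOc; apply: ny; exists c.
  move=> y z Oy Oz c c' cy c'z m.
  have := OP _ (inO _ _ Oy cy) m; have := OP _ (inO _ _ Oz c'z) m.
  by rewrite !ler_norml; lra.
have [D [cD DE]] := diag_nbhs_cpmetric dE.
have [D0 Ds Dt D1 Dc] := cD.
exists (fun x y => Num.min 1 (4 * D x y)); split.
  apply: cpmetric_min1.
  - by move=> x; rewrite D0 mulr0.
  - by move=> x y; rewrite Ds.
  - by move=> x y z; have := Dt x y z; lra.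
  - move=> x e e0; have e40 : 0 < e / 4 by lra.
    by apply: filterS (Dc x _ e40) => y; lra.
move=> m b b'; rewrite le_min; apply/andP; split.
  by have := f01 m b; have := f01 m b'; rewrite ler_norml; lra.
(* The factor 4 drives a bootstrap: a distance below 2 ^ -(n + 1) bounds the difference by 2 ^ -n,
   and as 4 times the distance is less than the difference, the distance is below 2 ^ -(n + 2). The
   difference would then vanish. *)
rewrite leNgt; apply/negP => h.
have Dn n : D (j b) (j b') < 2^-1 ^+ n.+1.
  elim: n => [|n IH].
    have : `|f m b - f m b'| <= 1.
      by have := f01 m b; have := f01 m b'; rewrite ler_norml; lra.
    by rewrite expr1; lra.
  have := DE n _ _ IH _ _ erefl erefl m;
    rewrite [_ ^+ n.+2]exprS [_ ^+ n.+1]exprS; lra.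
have p0 : 0 < `|f m b - f m b'|.
  by have := cpmetric_ge0 (j b) (j b') cD; lra.
have [n qn] := expr2V_lt p0.
by have := DE n _ _ (Dn n) _ _ erefl erefl m; rewrite leNgt qn.
Qed.

End Domination.

(** * Compact group actions *)

(** The tube lemma. *)
Lemma compact_near_all (T K : topologicalType) (P : T -> K -> Prop) (x : T) :
  compact [set: K] ->
  (forall k : K, \forall k' \near k & x' \near x, P x' k') ->
  \forall x' \near x, forall k, P x' k.
Proof.
move=> /compact_near_coveringP cK H.
have := cK T (nbhs x) P _ (fun k _ => H k).
by move=> /(_ _)h; apply: filterS h => y yP k; exact: yP.
Qed.

Lemma cpmetric_near_compact (R : realType) (K T U : topologicalType)
    (c : K * T -> U) (D : U -> U -> R) (x : T) (e : R) :
  compact [set: K] -> continuous c -> cpmetric D -> 0 < e ->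
  \forall y \near x, forall k, D (c (k, x)) (c (k, y)) < e.
Proof.
move=> cK cc [D0 Ds Dt D1 Dc] e0; apply: compact_near_all => // k.
have e20 : 0 < e / 2 by lra.
have [[N V] [/= kN xV] NV] := cc (k, x) _ (Dc (c (k, x)) _ e20).
exists (N, V) => // -[l y] [/= Nl Vy].
have := NV (l, y) (conj Nl Vy); have := NV (l, x) (conj Nl (nbhs_singleton xV)).
move=> /= h1 h2; have := Dt (c (l, x)) (c (k, x)) (c (l, y)).
by rewrite (Ds _ (c (k, x))); lra.
Qed.

Lemma hausdorff_continuous_inj (T U : topologicalType) (f : T -> U) :
  continuous f -> injective f -> hausdorff_space U -> hausdorff_space T.
Proof.
move=> cf fi hU x y xy; apply: fi; apply: hU => A B xA yB.
have [z [Az Bz]] := xy _ _ (cf x _ xA) (cf y _ yB).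
by exists (f z).
Qed.

Lemma closed_embedding_nbhs (A W : topologicalType) (i : A -> W) (a : A)
    (Q : set A) : closed_embedding i -> nbhs a Q ->
  \forall w \near i a, forall b, i b = w -> Q b.
Proof.
move=> [ci ii icl] aQ; have : nbhs (i a) (~` (i @` ~` Q°)).
  apply: open_nbhs_nbhs; split;
    first exact/closed_openC/icl/open_closedC/open_interior.
  by move=> [b nQb] /ii ba; apply: nQb; rewrite ba; exact: aQ.
apply: filterS => w nw b bw; apply: interior_subset; apply: contrapT => nQb.
by apply: nw; exists b.
Qed.

Lemma closed_embedding_nbhsC (A W : topologicalType) (i : A -> W) (w : W) :
  closed_embedding i -> ~ range i w -> \forall w' \near w, ~ range i w'.
Proof.
move=> [_ _ icl] nw; apply: open_nbhs_nbhs; split=> //.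
exact/closed_openC/icl/closedT.
Qed.

Lemma closed_embedding_prod (A W K : topologicalType) (i : A -> W) :
  closed_embedding i -> closed_embedding (fun p : A * K => (i p.1, p.2)).
Proof.
move=> ei; have [ci ii icl] := ei; split.
- apply: continuous_pair; last exact: snd_continuous.
  exact: (continuous_comp_fun (@fst_continuous A K) ci).
- by move=> [a k] [b l] [/ii-> ->].
move=> C cC [w k] wC; have [[a _ aw]|nw] := pselect (range i w); last first.
  have : nbhs (w, k) [set p | ~ range i p.1].
    exists ([set w | ~ range i w], setT); last by move=> [? ?] [].
    by split; [exact: closed_embedding_nbhsC|exact: filterT].
  by move=> /wC[_ [[[a l] _ <-] /=]] []; exists a.
suff Cak : C (a, k) by exists (a, k) => //; rewrite /= aw.
apply: cC => B [[B1 B2] [/= aB1 kB2] sB].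
have : nbhs (w, k) [set p | (forall b, i b = p.1 -> B1 b) /\ B2 p.2].
  exists ([set w | forall b, i b = w -> B1 b], B2); last by move=> [? ?] [].
  by split => //=; rewrite -aw; exact: closed_embedding_nbhs.
move=> /wC[_ [[[b l] Cbl <-] /= [bB lB]]]; exists (b, l); split => //.
by apply: sB; split => //=; exact: bB.
Qed.

Section ParacompactConstructions.
Context {R : realType}.

Lemma p_paracompact_prod (T U : topologicalType) :
  p_paracompact R T -> p_paracompact R U -> p_paracompact R (T * U)%type.
Proof.
move=> /paracompact_perfect_pm[hT [D [cD pD]]].
move=> /paracompact_perfect_pm[hU [D' [cD' pD']]].
apply: (@perfect_pm_paracompact _ _
  (fun x y => Num.max (D x.1 y.1) (D' x.2 y.2))).
- move=> [t u] [t' u'] H; congr pair.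
    apply: hT => A B tA t'B.
    have [||[x y] [/= Ax Bx]] := H (fst @^-1` A) (fst @^-1` B);
      last by exists x.
      by exists (A, setT) => //=; [split=> //; exact: filterT|move=> [? ?] []].
    by exists (B, setT) => //=; [split=> //; exact: filterT|move=> [? ?] []].
  apply: hU => A B tA t'B.
  have [||[x y] [/= Ax Bx]] := H (snd @^-1` A) (snd @^-1` B); last by exists y.
    by exists (setT, A) => //=; [split=> //; exact: filterT|move=> [? ?] []].
  by exists (setT, B) => //=; [split=> //; exact: filterT|move=> [? ?] []].
- apply: cpmetric_max.
    by apply: (cpmetric_comp _ cD) => x; exact: cvg_fst.
  by apply: (cpmetric_comp _ cD') => x; exact: cvg_snd.
- exact: perfect_pm_prod.
Qed.

Lemma p_paracompact_compact (T : topologicalType) :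
  compact [set: T] -> hausdorff_space T -> p_paracompact R T.
Proof.
move=> cT hT; apply: (@perfect_pm_paracompact _ _ (fun _ _ => 0)) => //.
  exact: cpmetric_cst0.
exact: perfect_pm_compact.
Qed.

Lemma p_paracompact_closed_embedding (T U : topologicalType) (i : T -> U) :
  closed_embedding i -> p_paracompact R U -> p_paracompact R T.
Proof.
move=> ei /paracompact_perfect_pm[hU [D [cD pD]]]; have [ci ii _] := ei.
apply: (@perfect_pm_paracompact _ _ (fun x y => D (i x) (i y))).
- exact: hausdorff_continuous_inj hU.
- exact: cpmetric_comp.
- exact: perfect_pm_closed_embedding.
Qed.

Lemma p_paracompact_real : p_paracompact R R.
Proof.
split; first exact: Rhausdorff.
exists R^o, (fun x => x); split.
- by move=> x; exact: cvg_id.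
- by move=> y; exists y.
- by move=> C cC; rewrite image_id.
- move=> y; rewrite (_ : _ @^-1` _ = [set y])//; exact: compact_set1.
Qed.

End ParacompactConstructions.

Section GSpaces.
Context {G : topGroupType}.
Local Open Scope group_scope.

Section Prod.
Variables X Y : gspace G.
Definition prod_act (g : G) (p : X * Y) : X * Y := (gact g p.1, gact g p.2).
Fact prod_act1 p : prod_act 1 p = p.
Proof. by case: p => x y; rewrite /prod_act !gact1. Qed.
Fact prod_actM g h p : prod_act (g * h) p = prod_act g (prod_act h p).
Proof. by rewrite /prod_act !gactM. Qed.
Fact prod_act_continuous : continuous (fun z : G * (X * Y) => prod_act z.1 z.2).
Proof.
have c1 := @fst_continuous G (X * Y)%type.
have c2 := @snd_continuous G (X * Y)%type.
apply: continuous_pair.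
  have c := continuous_comp_fun c2 (@fst_continuous X Y).
  exact: (continuous_comp_fun (continuous_pair c1 c) (@gact_continuous G X)).
have c := continuous_comp_fun c2 (@snd_continuous X Y).
exact: (continuous_comp_fun (continuous_pair c1 c) (@gact_continuous G Y)).
Qed.
Definition prod_gspace : gspace G :=
  GSpace prod_act1 prod_actM prod_act_continuous.
End Prod.

(** Under the diagonal action (g w, k g^-1) the product k w is invariant. A family with f (g a) k =
    f a (k g), such as the coordinates of a G-map into functions on G, is thereby an invariant
    function on the product. *)
Definition rtrans_act (g k : G) : G := k * g^-1.
Fact rtrans_act1 k : rtrans_act 1 k = k.
Proof. by rewrite /rtrans_act invg1 mulg1. Qed.
Fact rtrans_actM g h k : rtrans_act (g * h) k = rtrans_act g (rtrans_act h k).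
Proof. by rewrite /rtrans_act invgM mulgA. Qed.
Fact rtrans_act_continuous : continuous (fun z : G * G => rtrans_act z.1 z.2).
Proof.
have c := continuous_comp_fun (@fst_continuous G G) (@invg_continuous G).
exact: (continuous_comp_fun (continuous_pair (@snd_continuous G G) c)
  (@mulg_continuous G)).
Qed.
Definition rtrans_gspace : gspace G :=
  GSpace rtrans_act1 rtrans_actM rtrans_act_continuous.

Lemma gact_continuousr (X : gspace G) (g : G) : continuous (@gact G X g).
Proof.
exact: (continuous_comp_fun (continuous_pair (@cst_continuous X G g)
  (fun x => cvg_id)) (@gact_continuous G X)).
Qed.

Lemma gact_continuousl (X : gspace G) (x : X) :
  continuous (fun g : G => gact g x).
Proof.
exact: (continuous_comp_fun (continuous_pair (fun x => cvg_id)
  (@cst_continuous G X x)) (@gact_continuous G X)).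
Qed.

Lemma mulg_continuousr (g : G) : continuous (fun h : G => g * h).
Proof.
exact: (continuous_comp_fun (continuous_pair (@cst_continuous G G g)
  (fun x => cvg_id)) (@mulg_continuous G)).
Qed.

Lemma mulg_continuousl (g : G) : continuous (fun h : G => h * g).
Proof.
exact: (continuous_comp_fun (continuous_pair (fun x => cvg_id)
  (@cst_continuous G G g)) (@mulg_continuous G)).
Qed.

Lemma gactK (X : gspace G) (g : G) : cancel (@gact G X g) (gact g^-1).
Proof. by move=> x; rewrite -gactM mulVg gact1. Qed.

Lemma gactVK (X : gspace G) (g : G) : cancel (@gact G X g^-1) (gact g).
Proof. by move=> x; rewrite -gactM mulgV gact1. Qed.

End GSpaces.

Section GSup.
Context {R : realType} {G : topGroupType}.
Hypothesis compactG : compact [set: G].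

(** An invariant pseudometric above D, whose continuity comes from the compactness of G. *)
Definition gsup (X : gspace G) (D : X -> X -> R) (x y : X) : R :=
  supr (fun g : G => D (gact g x) (gact g y)).

Lemma gsup_ub (X : gspace G) (D : X -> X -> R) x y :
  cpmetric D -> D x y <= gsup D x y.
Proof.
move=> [_ _ _ D1 _]; rewrite -{1}[x]gact1 -{1}[y]gact1.
exact: (@supr_ub _ _ (fun g : G => D (gact g x) (gact g y))).
Qed.

Lemma gsup_act (X : gspace G) (D : X -> X -> R) g x y :
  gsup D (gact g x) (gact g y) = gsup D x y.
Proof.
rewrite /gsup /supr; congr sup; apply/seteqP; split=> _ [h _ <-].
  by exists (h * g)%g => //; rewrite !gactM.
by exists (h * g^-1)%g => //; rewrite !gactM !gactK.
Qed.

Lemma cpmetric_near_act (X : gspace G) (D : X -> X -> R) x (e : R) :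
  cpmetric D -> 0 < e ->
  \forall y \near x, forall g : G, D (gact g x) (gact g y) < e.
Proof.
move=> cD e0.
exact: (cpmetric_near_compact x compactG (@gact_continuous G X) cD e0).
Qed.

Lemma gsup_cpmetric (X : gspace G) (D : X -> X -> R) :
  cpmetric D -> cpmetric (gsup D).
Proof.
move=> cD; have [D0 Ds Dt D1 Dc] := cD.
have D01 x y : 0 <= D x y <= 1 by exact: cpmetric_in01.
split.
- move=> x; apply/eqP; rewrite eq_le supr_ge0// andbT.
  by apply: supr_le => // g; rewrite D0.
- by move=> x y; rewrite /gsup; congr supr; apply/funext => g; rewrite Ds.
- move=> x y z; apply: supr_leD => //; first exact: supr_ge0.
  move=> g; apply: (le_trans (Dt _ (gact g y) _)); rewrite lerD2l.
  exact: (@supr_ub _ _ (fun g : G => D (gact g y) (gact g z))).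
- by move=> x y; exact: supr_le1.
- move=> x e e0; have e20 : 0 < e / 2 by lra.
  apply: filterS (cpmetric_near_act x cD e20) => y xy.
  suff : gsup D x y <= e / 2 by lra.
  by apply: supr_le => [|g]; [exact: ltW|apply/ltW; exact: xy].
Qed.

End GSup.

Section EquivariantExtension.
Context {R : realType} {G : topGroupType}.
Hypothesis compactG : compact [set: G].
Hypothesis hausdorffG : hausdorff_space G.
Variables (A W : gspace G) (i : gmap A W) (H : set G).
Hypothesis ei : closed_embedding i.
Hypothesis pW : p_paracompact R W.

(* McShane's formula applied to a pseudometric D on W * G that is invariant
   under g (w, k) = (g w, k g^-1) preserves every symmetry of f. *)
Lemma equivariant_mcshane (M : Type) (f : M -> A -> G -> R) :
  (forall m a k, 0 <= f m a k <= 1) ->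
  (forall a k e, 0 < e -> \forall p \near (a, k), forall m,
     `|f m a k - f m p.1 p.2| <= e) ->
  (forall m h a k, H h -> f m (gact h a) (k * h^-1)%g = f m a k) ->
  exists (F : M -> W -> G -> R) (D : W * G -> W * G -> R),
  [/\ cpmetric D, (forall m w k, 0 <= F m w k <= 1),
      (forall m a k, F m (i a) k = f m a k),
      (forall m h w k, H h -> F m (gact h w) (k * h^-1)%g = F m w k) &
      (forall m w k w' k', `|F m w k - F m w' k'| <= D (w, k) (w', k'))].
Proof.
move=> f01 fc fH.
have pWG : p_paracompact R (W * G)%type.
  by apply: p_paracompact_prod => //; exact: p_paracompact_compact.
pose j (p : A * G) : W * G := (i p.1, p.2).
have ej : closed_embedding j by exact: closed_embedding_prod.
have [||D1 [cD1 fD1]] := cpmetric_dominating pWG (f := fun m p => f m p.1 p.2)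
  ej.
- by move=> m [a k]; exact: f01.
- by move=> [a k] e e0; exact: fc.
pose WG : gspace G := prod_gspace W (rtrans_gspace (G := G)).
pose D : W * G -> W * G -> R := gsup (X := WG) D1.
have cD : cpmetric D by exact: (gsup_cpmetric compactG (X := WG) cD1).
have fD m p p' : `|f m p.1 p.2 - f m p'.1 p'.2| <= D (j p) (j p').
  apply: (le_trans (fD1 m p p')).
  exact: (@gsup_ub _ _ WG D1 (j p) (j p') cD1).
have Dact h p p' : D (gact h p.1, (p.2 * h^-1)%g) (gact h p'.1, (p'.2 * h^-1)%g)
    = D p p' := @gsup_act _ _ WG D1 h p p'.
(* The cut-off at 0 keeps the values in [0, 1], also when A is empty. *)
pose F m w k := supr (fun p : A * G =>
  Num.max 0 (f m p.1 p.2 - D (w, k) (j p))).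
have t01 m w k (p : A * G) :
    0 <= Num.max 0 (f m p.1 p.2 - D (w, k) (j p)) <= 1.
  have := f01 m p.1 p.2; have := cpmetric_ge0 (w, k) (j p) cD.
  by rewrite maxEle; case: ifP; lra.
exists F, D; split => //.
- by move=> m w k; exact: supr_in01.
- move=> m a k; apply/eqP; rewrite eq_le; apply/andP; split.
    apply: supr_le => [|p]; first by have /andP[] := f01 m a k.
    have := f01 m a k; have := fD m (a, k) p;
      rewrite /= ler_norml => /andP[h1 h2] /andP[h3 h4].
    by rewrite ge_max h3 /=; move: h1 h2; rewrite /j/=; lra.
  have := @supr_ub _ _ (fun p : A * G =>
    Num.max 0 (f m p.1 p.2 - D (i a, k) (j p))) (a, k).
  rewrite -/(F m (i a) k) => /(_ _)h.
  have {h} : Num.max 0 (f m a k - D (i a, k) (j (a, k))) <= F m (i a) k.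
    by apply: h => p; have /andP[] := t01 m (i a) k p.
  rewrite ge_max => /andP[_]; rewrite /j/=.
  by have [-> _ _ _ _] := cD; rewrite subr0.
- move=> m h w k Hh; rewrite /F /supr; congr sup; apply/seteqP;
    split=> _ [[a l] _ <-] /=.
    exists (gact h^-1%g a, (l * h)%g) => //=.
    rewrite -(fH m h _ _ Hh) gactVK mulgK; congr (Num.max 0 (_ - _)).
    rewrite -(Dact h (w, k)) /j /=.
    by rewrite mulgK -gfun_equivariant gactVK.
  exists (gact h a, (l * h^-1)%g) => //=.
  rewrite fH//; congr (Num.max 0 (_ - _)).
  rewrite -(Dact h (w, k)) /j /=.
  by rewrite gfun_equivariant.
- move=> m w k w' k'; apply: supr_dist => //; first exact: cpmetric_ge0.
  move=> p; apply: max0_lipschitz; have := cpmetric_dist (w', k') (w, k) (j p)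
    cD.
  have [_ Ds _ _ _] := cD; rewrite (Ds (w', k') (w, k)) !ler_norml; lra.
Qed.

End EquivariantExtension.

(** * The universal space *)

Lemma hausdorff_nbhs_neq (T : topologicalType) (x y : T) :
  hausdorff_space T -> x <> y -> nbhs x (~` [set y]).
Proof.
move=> hT xy; apply: open_nbhs_nbhs; split; last by move=> /= ?; exact: xy.
apply: closed_openC; exact: (accessible_closed_set1 (hausdorff_accessible hT)).
Qed.
Lemma near_all (T I : Type) (F : set_system T) (p : I -> T -> bool)
    (l : seq I) :
  Filter F -> (forall i, F [set x | p i x]) -> F [set x | all (p ^~ x) l].
Proof.
move=> FF Fp; elim: l => [|i l IH]; first exact: filterE.
by apply: filterS (filterI (Fp i) IH) => x /= [-> ->].
Qed.

Section Universal.
Context {R : realType} {G : topGroupType} (Y : gspace G) (d : Y -> Y -> R).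
(** The right invariant modulus of the orbit functions is part of the data: the functions on G with
    values in [0, 1] that respect it form a compact set stable under right translations, and
    translation acts continuously on it. *)
Record coordinate := Coordinate {
  cfun : Y -> R;
  cmod : G -> G -> R;
  cfun01 : forall y, 0 <= cfun y <= 1;
  cfun_continuous : continuous cfun;
  cmod_cpmetric : cpmetric cmod;
  cmodM : forall k l g, cmod (k * g)%g (l * g)%g = cmod k l;
  cfun_cmod : forall y k l, `|cfun (gact k y) - cfun (gact l y)| <= cmod k l
}.

(* The points of the universal space: [zb] is an element of the space of maps
   from G to the metrizable convex set of functions on Y, with one more
   coordinate [None] whose vanishing forces [zb] to be the Kuratowski image of
   an orbit map of Y, so that Y is closed; [zc] lies in a compact space. *)
Record zpt := ZPt {
  zb : G -> option Y -> R;
  zc : coordinate -> G -> R;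
  zb01 : forall k m, 0 <= zb k m <= 1;
  zc01 : forall q k, 0 <= zc q k <= 1;
  zb_cont : forall (g0 : G) (e : R), 0 < e ->
    \forall g \near g0, forall k m, `|zb (k * g0)%g m - zb (k * g)%g m| <= e;
  zb_point : (forall k, zb k None = 0) ->
    exists y, forall k m, zb k (Some m) = d (gact k y) m;
  zc_lip : forall q k l, `|zc q k - zc q l| <= cmod q k l
}.

Lemma zpt_eq z z' : (forall k m, zb z k m = zb z' k m) ->
  (forall q k, zc z q k = zc z' q k) -> z = z'.
Proof.
case: z z' => [b c ? ? ? ? ?] [b' c' ? ? ? ? ?] /= bb cc.
have eb : b = b' by apply/funext => k; apply/funext => m.
have ec : c = c' by apply/funext => q; apply/funext => k.
by subst b' c'; f_equal; exact: Prop_irrelevance.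
Qed.

HB.instance Definition _ := gen_eqMixin zpt.
HB.instance Definition _ := gen_choiceMixin zpt.

(** Uniform closeness of [zb] and pointwise closeness of [zc] at finitely many indices: the product
    topology of a metrizable and a compact factor. *)
Definition znear e (l : seq (coordinate * G)) z z' : Prop :=
  (forall k m, `|zb z k m - zb z' k m| <= e) /\
  all (fun p => `|zc z p.1 p.2 - zc z' p.1 p.2| <= e) l.

Definition znbhs (z : zpt) : set_system zpt :=
  [set U | exists e l, 0 < e /\ forall z', znear e l z z' -> U z'].

HB.instance Definition _ := hasNbhs.Build zpt znbhs.

Fact znear_refl e l z : 0 < e -> znear e l z z.
Proof.
move=> e0; split=> [k m|]; first by rewrite subrr normr0 ltW.
by elim: l => //= p l ->; rewrite subrr normr0 ltW.
Qed.

Fact znbhs_filter (z : zpt) : ProperFilter (nbhs z).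
Proof.
apply: Build_ProperFilter_ex => [U [e [l [e0 U1]]]|].
  by exists z; apply: U1; exact: znear_refl.
split.
- by exists 1, [::]; split.
- move=> U V [e [l [e0 U1]]] [e' [l' [e'0 V1]]].
  exists (Num.min e e'), (l ++ l'); split; first by rewrite lt_min e0.
  move=> z' [zz']; rewrite all_cat => /andP[al al'].
  split; [apply: U1|apply: V1]; split.
  + by move=> k m; have := zz' k m; rewrite le_min => /andP[].
  + by apply: sub_all al => p; rewrite le_min => /andP[].
  + by move=> k m; have := zz' k m; rewrite le_min => /andP[].
  + by apply: sub_all al' => p; rewrite le_min => /andP[].
- by move=> U V UV [e [l [e0 U1]]]; exists e, l; split=> // z' /U1/UV.
Qed.

Fact znbhs_singleton (z : zpt) (U : set zpt) : nbhs z U -> U z.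
Proof. by move=> [e [l [e0]]]; apply; exact: znear_refl. Qed.

Fact znbhs_nbhs (z : zpt) (U : set zpt) : nbhs z U -> nbhs z (nbhs^~ U).
Proof.
move=> [e [l [e0 U1]]]; exists (e / 2), l; split; first lra.
move=> z' [bz' cz']; exists (e / 2), l; split; first lra.
move=> z'' [bz'' cz'']; apply: U1; split.
  move=> k m; apply: (le_trans (ler_distD (zb z' k m) _ _)).
  by have := bz' k m; have := bz'' k m; lra.
have : all (predI (fun p => `|zc z p.1 p.2 - zc z' p.1 p.2| <= e / 2)
  (fun p => `|zc z' p.1 p.2 - zc z'' p.1 p.2| <= e / 2)) l.
  by rewrite all_predI cz'.
apply: sub_all => p /= /andP[h h'].
by apply: (le_trans (ler_distD (zc z' p.1 p.2) _ _)); lra.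
Qed.

HB.instance Definition _ := Nbhs_isNbhsTopological.Build zpt
  znbhs_filter znbhs_singleton znbhs_nbhs.

Lemma zb_near z e : 0 < e ->
  \forall z' \near z, forall k m, `|zb z k m - zb z' k m| <= e.
Proof. by move=> e0; exists e, [::]; split=> // z' []. Qed.
Lemma zc_near z q k e : 0 < e ->
  \forall z' \near z, `|zc z q k - zc z' q k| <= e.
Proof. by move=> e0; exists e, [:: (q, k)]; split=> // z' [_ /= /andP[]]. Qed.

Lemma zpt_continuous (W : topologicalType) (f : W -> zpt) :
  (forall w e, 0 < e ->
    \forall w' \near w, forall k m, `|zb (f w) k m - zb (f w') k m| <= e) ->
  (forall q k w e, 0 < e ->
    \forall w' \near w, `|zc (f w) q k - zc (f w') q k| <= e) ->
  continuous f.
Proof.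
move=> cb cc w U [e [l [e0 U1]]].
have Fc : nbhs w [set w' | all (fun p => `|zc (f w) p.1 p.2 - zc (f w') p.1 p.2|
  <= e) l].
  by apply: (near_all (p := fun p w' => `|zc (f w) p.1 p.2 - zc (f w') p.1 p.2|
    <= e)) => -[q k]; exact: cc.
by apply: filterS (filterI (cb w e e0) Fc) => w' [? ?]; exact: U1.
Qed.

Lemma zpt_hausdorff : hausdorff_space zpt.
Proof.
move=> z z' zz'; apply: zpt_eq.
  move=> k m; apply/eqP; rewrite -subr_eq0 -normr_eq0 eq_le normr_ge0 andbT.
  apply/ler_addgt0Pl => e e0; have e20 : 0 < e / 2 by lra.
  have [z'' [/= h h']] := zz' _ _ (zb_near z e20) (zb_near z' e20).
  rewrite addr0; apply: (le_trans (ler_distD (zb z'' k m) _ _)).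
  by have := h k m; have := h' k m; rewrite (distrC (zb z' k m)); lra.
move=> q k; apply/eqP; rewrite -subr_eq0 -normr_eq0 eq_le normr_ge0 andbT.
apply/ler_addgt0Pl => e e0; have e20 : 0 < e / 2 by lra.
have [z'' [/= h h']] := zz' _ _ (zc_near z q k e20) (zc_near z' q k e20).
rewrite addr0; apply: (le_trans (ler_distD (zc z'' q k) _ _)).
by move: h h'; rewrite (distrC (zc z' q k)); lra.
Qed.

Definition zdist z z' : R :=
  supr (fun p : G * option Y => `|zb z p.1 p.2 - zb z' p.1 p.2|).

Let zterm01 z z' (p : G * option Y) : 0 <= `|zb z p.1 p.2 - zb z' p.1 p.2| <= 1.
Proof.
rewrite normr_ge0 ler_norml; have := zb01 z p.1 p.2.
by have := zb01 z' p.1 p.2; lra.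
Qed.

Lemma zdist_ub z z' k m : `|zb z k m - zb z' k m| <= zdist z z'.
Proof.
apply: (@supr_ub _ _ (fun p : G * option Y => `|zb z p.1 p.2 - zb z' p.1 p.2|)
  (k, m)).
by move=> p; have /andP[] := zterm01 z z' p.
Qed.

Lemma zdist_le z z' e : 0 <= e -> (forall k m, `|zb z k m - zb z' k m| <= e) ->
  zdist z z' <= e.
Proof. by move=> e0 h; apply: supr_le => // -[k m]. Qed.

Lemma zdist_cpmetric : cpmetric zdist.
Proof.
split.
- move=> z; apply/eqP; rewrite eq_le zdist_le//=; last by move=> k m;
    rewrite subrr normr0.
  exact: supr_ge0.
- by move=> z z'; congr supr; apply/funext => p; rewrite distrC.
- move=> z z' z''; apply: supr_leD => //; first exact: supr_ge0.
  move=> p; apply: (le_trans (ler_distD (zb z' p.1 p.2) _ _)); rewrite lerD2l.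
  exact: zdist_ub.
- by move=> z z'; apply: supr_le1 => p; have /andP[] := zterm01 z z' p.
- move=> z e e0; have e20 : 0 < e / 2 by lra.
  apply: filterS (zb_near z e20) => z' zz'.
  by have := zdist_le (ltW e20) zz'; lra.
Qed.

(** The limit keeps [zb] of z, and with it the conditions on [zb]. Its [zc] is the coordinatewise
    limit in [0, 1], to which the Lipschitz bounds pass. *)
Lemma zdist_perfect : perfect_pm zdist.
Proof.
move=> z F FU Fz.
have Fb e : 0 < e -> F [set z' | forall k m, `|zb z k m - zb z' k m| <= e].
  move=> e0; apply: filterS (Fz e e0) => z' /= zz' k m.
  by have := zdist_ub z z' k m; lra.
have climP (p : coordinate * G) : exists c : R, 0 <= c <= 1 /\
    forall e, 0 < e -> F [set z' | `|c - zc z' p.1 p.2| <= e].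
  have cI : compact `[0%R, 1%R : R] by exact: normed_module.segment_compact.
  rewrite compact_ultra in cI.
  have [|c [c01 Fc]] := cI _ (fmap_ultra (fun z' => zc z' p.1 p.2) FU).
    suff : F [set z' | `[0, 1]%classic (zc z' p.1 p.2)] by [].
    by apply: filterE => z' /=; rewrite in_itv/=; exact: zc01.
  exists c; split; first by move: c01; rewrite /= in_itv.
  move=> e e0.
  have Fce : F [set z' | ball c e (zc z' p.1 p.2)] := Fc _ (nbhsx_ballx c e e0).
  by apply: filterS Fce => z' /= h; exact: ltW.
have [c cP] := choice climP.
have c01 q k : 0 <= c (q, k) <= 1 by have [] := cP (q, k).
have clip q k l : `|c (q, k) - c (q, l)| <= cmod q k l.
  apply/ler_addgt0Pl => e e0; have e20 : 0 < e / 2 by lra.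
  have [_ /(_ _ e20) h1] := cP (q, k); have [_ /(_ _ e20) h2] := cP (q, l).
  have [z' [/= a b]] := filter_ex (filterI h1 h2).
  by have := zc_lip z' q k l; move: a b; rewrite !ler_norml; lra.
pose z' := @ZPt (zb z) (fun q k => c (q, k)) (zb01 z) c01 (@zb_cont z)
  (@zb_point z) clip.
exists z' => U [e [l [e0 U1]]].
have Fc : F [set z'' | all (fun p => `|zc z' p.1 p.2 - zc z'' p.1 p.2| <= e) l].
  apply: (near_all (p := fun p z'' => `|zc z' p.1 p.2 - zc z'' p.1 p.2| <= e))
    => -[q k].
  by have [_] := cP (q, k); apply.
by apply: filterS (filterI (Fb e e0) Fc) => z'' [? ?]; exact: U1.
Qed.

Lemma zpt_paracompact : p_paracompact R zpt.
Proof. exact: perfect_pm_paracompact zpt_hausdorff zdist_cpmetric zdist_perfect.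
Qed.
End Universal.

(** * The action on the universal space and the embedding of Y *)

Section UniversalAction.
Context {R : realType} {G : topGroupType}.
Hypothesis compactG : compact [set: G].
Variables (Y : gspace G) (d : Y -> Y -> R).
Local Notation Z := (zpt d).

Fact zact_cont (g : G) (z : Z) (g0 : G) (e : R) : 0 < e ->
  \forall h \near g0, forall k m,
    `|zb z (k * g0 * g)%g m - zb z (k * h * g)%g m| <= e.
Proof.
move=> e0; have c := @mulg_continuousl G g.
have h0 : \forall h \near g0, forall k m,
    `|zb z (k * (g0 * g))%g m - zb z (k * (h * g))%g m| <= e.
  exact: (c g0 _ (@zb_cont _ _ _ _ z (g0 * g)%g e e0)).
apply: filterS h0 => h hh k m.
by rewrite -!mulgA; exact: hh.
Qed.

Fact zact_point (g : G) (z : Z) : (forall k, zb z (k * g)%g None = 0) ->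
  exists y, forall k m, zb z (k * g)%g (Some m) = d (gact k y) m.
Proof.
move=> h; have [k|y yP] := zb_point (z := z).
  by rewrite -(h (k * g^-1)%g) mulgVK.
by exists (gact g y) => k m; rewrite yP gactM.
Qed.

Fact zact_lip (g : G) (z : Z) q k l :
  `|zc z q (k * g)%g - zc z q (l * g)%g| <= cmod q k l.
Proof. by rewrite -(cmodM q k l g); exact: zc_lip. Qed.

Definition zact (g : G) (z : Z) : Z :=
  @ZPt R G Y d (fun k m => zb z (k * g)%g m) (fun q k => zc z q (k * g)%g)
    (fun k m => zb01 z (k * g)%g m) (fun q k => zc01 z q (k * g)%g)
    (@zact_cont g z) (@zact_point g z) (@zact_lip g z).

Fact zact1 z : zact 1%g z = z.
Proof. by apply: zpt_eq => /= *; rewrite mulg1. Qed.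

Fact zactM g h z : zact (g * h)%g z = zact g (zact h z).
Proof. by apply: zpt_eq => /= *; rewrite mulgA. Qed.

Fact zact_continuous : continuous (fun p : G * Z => zact p.1 p.2).
Proof.
apply: zpt_continuous => [[g z] e e0 /=|q k [g z] e e0 /=].
  have e20 : 0 < e / 2 by lra.
  exists ([set g' | forall k m, `|zb z (k * g)%g m - zb z (k * g')%g m| <= e /
    2],
    [set z' | forall k m, `|zb z k m - zb z' k m| <= e / 2]).
    by split => /=; [exact: zb_cont|exact: zb_near].
  move=> [g' z'] [/= gg' zz'] k m.
  apply: (le_trans (ler_distD (zb z (k * g')%g m) _ _)).
  by have := gg' k m; have := zz' (k * g')%g m; lra.
have e20 : 0 < e / 2 by lra.
have c := @mulg_continuousr G k.
have [_ _ _ _ mc] := cmod_cpmetric q.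
exists ([set g' | cmod q (k * g)%g (k * g')%g < e / 2],
    [set z' | `|zc z q (k * g)%g - zc z' q (k * g)%g| <= e / 2]).
  by split => /=; [exact: (c g _ (mc _ _ e20))|exact: zc_near].
move=> [g' z'] [/= gg' zz'].
apply: (le_trans (ler_distD (zc z' q (k * g)%g) _ _)).
by have := zc_lip z' q (k * g)%g (k * g')%g; lra.
Qed.

Definition zspace : gspace G := GSpace zact1 zactM zact_continuous.

Section Embedding.
Hypothesis cd : cpmetric d.
Hypothesis pd : perfect_pm d.
Hypothesis hY : hausdorff_space Y.
Hypothesis hausdorffG : hausdorff_space G.

Let eb (y : Y) (k : G) (m : option Y) : R :=
  if m is Some m then d (gact k y) m else 0.

Fact zembed_b01 y k m : 0 <= eb y k m <= 1.
Proof. by case: m => [m|] /=; [exact: cpmetric_in01|rewrite lexx ler01]. Qed.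

Fact zembed_cont y (g0 : G) (e : R) : 0 < e ->
  \forall g \near g0, forall k m, `|eb y (k * g0)%g m - eb y (k * g)%g m| <= e.
Proof.
move=> e0; have c := @gact_continuousl G Y y.
have h0 : \forall g \near g0, forall k : G,
    d (gact k (gact g0 y)) (gact k (gact g y)) < e.
  exact: (c g0 _ (cpmetric_near_act compactG (gact g0 y) cd e0)).
apply: filterS h0 => g /= gg k [m|] /=; last by rewrite subrr normr0 ltW.
by have := gg k; have := cpmetric_dist (gact (k * g0)%g y) (gact (k * g)%g y) m
  cd; rewrite !gactM; lra.
Qed.

Fact zembed_point y : (forall k, eb y k None = 0) ->
  exists y', forall k m, eb y k (Some m) = d (gact k y') m.
Proof. by move=> _; exists y. Qed.

Definition zembed_fun (y : Y) : zspace :=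
  @ZPt R G Y d (eb y) (fun q k => cfun q (gact k y))
    (zembed_b01 y) (fun q k => cfun01 q (gact k y))
    (@zembed_cont y) (@zembed_point y) (fun q => cfun_cmod q y).

Fact zembed_continuous : continuous zembed_fun.
Proof.
apply: zpt_continuous => [y e e0|q k y e e0] /=.
  apply: filterS (cpmetric_near_act compactG y cd e0) => y' yy' k [m|] /=.
    by have := yy' k; have := cpmetric_dist (gact k y) (gact k y') m cd; lra.
  by rewrite subrr normr0 ltW.
have c := continuous_comp_fun (@gact_continuousr G Y k)
  (@cfun_continuous _ _ _ q).
move: c => /real_continuous c.
by apply: filterS (c y e e0) => y'; exact: ltW.
Qed.

Fact zembed_equivariant g y : zembed_fun (gact g y) = gact g (zembed_fun y).
Proof.
apply: zpt_eq => [k [m|]|q k] //=; by rewrite gactM.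
Qed.

Definition zembed : gmap Y zspace := GMap zembed_continuous zembed_equivariant.

(* The function is made uniformly continuous along orbits by a sup-convolution
   with a translation invariant pseudometric of G. *)
Lemma coordinate_separation (y y' : Y) : y <> y' ->
  exists q : @coordinate R G Y, cfun q y <> cfun q y'.
Proof.
move=> yy'.
have pY : p_paracompact R Y by exact: perfect_pm_paracompact hY cd pd.
have pG : p_paracompact R G by exact: p_paracompact_compact.
(* Points are closed, so excluding the single pair (y, y') leaves a diagonal neighbourhood; level 0
   then gives D y y' at least 1 / 2. *)
have [|D [cD DE]] := @diag_nbhs_cpmetric _ _ pY (fun _ a b => ~ (a = y /\ b =
  y')).
  move=> _ x; have [->|xy] := pselect (x = y).
    exists (~` [set y']); first exact: hausdorff_nbhs_neq.
    by move=> a b _ nb [_]; exact: nb.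
  exists (~` [set y]); first exact: hausdorff_nbhs_neq.
  by move=> a b na _ [+ _]; exact: na.
have Dyy' : 1 / 2 <= D y y'.
  rewrite leNgt; apply/negP => h; apply: (DE 0%N y y') => //.
  by rewrite expr1 -[X in _ < X]mul1r.
pose f x := D x y'.
have f01 x : 0 <= f x <= 1 by exact: cpmetric_in01.
have [D0 Ds Dt D1 Dc] := cD.
have fy' : f y' = 0 by exact: D0.
have flip a b : `|f a - f b| <= D a b by exact: cpmetric_dist.
have nearN : \forall g \near (1%g : G), f (gact g y') < 1 / 4.
  have c := @gact_continuousl G Y y'.
  have e40 : 0 < 1 / 4 :> R by lra.
  have h0 : \forall g \near (1%g : G), D (gact 1%g y') (gact g y') < 1 / 4.
    exact: (c 1%g _ (Dc _ _ e40)).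
  apply: filterS h0 => g /=.
  by rewrite gact1 Ds.
have [|D' [cD' DE']] := @diag_nbhs_cpmetric _ _ pG
    (fun _ a b => a = 1%g -> f (gact b y') < 1 / 4).
  move=> _ x; have [->|x1] := pselect (x = 1%g).
    by exists [set g | f (gact g y') < 1 / 4].
  exists (~` [set 1%g]); first exact: hausdorff_nbhs_neq.
  by move=> a b na _ a1; exfalso; exact: na.
pose delta : G -> G -> R := gsup (X := rtrans_gspace) D'.
have cdelta : cpmetric delta by exact: (gsup_cpmetric compactG (X :=
  rtrans_gspace)).
have deltaM k l g : delta (k * g)%g (l * g)%g = delta k l.
  by have := @gsup_act _ _ rtrans_gspace D' g^-1%g k l;
    rewrite /= /rtrans_act invgK.
have deltaN g : delta 1%g g < 1 / 2 -> f (gact g y') < 1 / 4.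
  move=> g1; apply: (DE' 0%N 1%g g) => //; rewrite expr1.
  apply: (@le_lt_trans _ _ (delta 1%g g)); last by rewrite -[X in _ < X]mul1r.
  exact: (@gsup_ub _ _ rtrans_gspace).
(* Halving f makes a penalty of 1 / 2 cancel every term away from the neighbourhood of 1 in which f
   (g y') stays below 1 / 4. *)
pose u x := supr (fun g => Num.max 0 (f (gact g x) / 2 - delta 1%g g)).
have t01 x g : 0 <= Num.max 0 (f (gact g x) / 2 - delta 1%g g) <= 1.
  have := f01 (gact g x); have := cpmetric_ge0 1%g g cdelta.
  by rewrite maxEle; case: ifP; lra.
have u01 x : 0 <= u x <= 1 by exact: supr_in01.
have uc : continuous u.
  apply/real_continuous => x e e0; have e20 : 0 < e / 2 by lra.
  apply: filterS (cpmetric_near_act compactG x cD e20) => x' xx'.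
  suff : `|u x - u x'| <= e / 2 by lra.
  apply: supr_dist => //; first lra.
  move=> g; apply: max0_lipschitz; have := flip (gact g x) (gact g x').
  by have := xx' g; rewrite !ler_norml; lra.
have uE k x : u (gact k x) = supr (fun h => Num.max 0 (f (gact h x) / 2 - delta
  k h)).
  rewrite /u /supr; congr sup; apply/seteqP; split=> _ [h _ <-].
    by exists (h * k)%g => //; rewrite -(deltaM 1%g h k) mul1g gactM.
  by exists (h * k^-1)%g => //; rewrite -(deltaM 1%g _ k) mul1g mulgVK gactM
    gactK.
have udelta x k l : `|u (gact k x) - u (gact l x)| <= delta k l.
  rewrite !uE; have s01 j h : 0 <= Num.max 0 (f (gact h x) / 2 - delta j h) <=
    1.
    have := f01 (gact h x); have := cpmetric_ge0 j h cdelta.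
    by rewrite maxEle; case: ifP; lra.
  apply: supr_dist => //; first exact: cpmetric_ge0.
  move=> h; apply: max0_lipschitz; have := cpmetric_dist l k h cdelta.
  by have [_ sd _ _ _] := cdelta; rewrite (sd l k) !ler_norml; lra.
exists (Coordinate u01 uc cdelta deltaM udelta) => /= uyy'.
have : 1 / 4 <= u y.
  have := @supr_ub _ _ (fun g => Num.max 0 (f (gact g y) / 2 - delta 1%g g))
    1%g.
  rewrite -/(u y) gact1 => /(_ _)h.
  have {h} : Num.max 0 (f y / 2 - delta 1%g 1%g) <= u y.
    by apply: h => g; have /andP[] := t01 y g.
  have [-> _ _ _ _] := cdelta.
  have fy : 1 / 2 <= f y by exact: Dyy'.
  by rewrite ge_max => /andP[_]; lra.
have : u y' <= 1 / 8.
  apply: supr_le => [|g]; first lra.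
  rewrite ge_max; apply/andP; split; first lra.
  have [/deltaN h|h] := ltP (delta 1%g g) (1 / 2).
    by have := cpmetric_ge0 1%g g cdelta; lra.
  by have := f01 (gact g y'); lra.
lra.
Qed.

(** Injectivity comes from the coordinates in the compact factor. For closedness, a limit z of image
    points has vanishing [None] coordinate, and [zb_point] supplies y0 with d(y0, .) tending to 0
    along the ultrafilter. Perfectness of d gives a limit y1, possibly different from y0, and z is
    its image. *)
Lemma zembed_closed_embedding : closed_embedding zembed.
Proof.
split; first exact: zembed_continuous.
  move=> y y' yy'; apply: contrapT => /coordinate_separation[q]; apply.
  have : zc (zembed y) q 1%g = zc (zembed y') q 1%g by rewrite yy'.
  by rewrite /= !gact1.
move=> C cC z zC.
have [|U zU|U V zU zV|F [FU FB]] := @ultra_separated Y (set Z)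
    (nbhs z) (fun U => C `&` zembed @^-1` U).
- by exists setT; exact: filterT.
- by have [_ [[y Cy <-] Uy]] := zC U zU; exists y.
- by exists (U `&` V); [exact: filterI|move=> y [? []]].
have Fz : zembed @ F --> z.
  by move=> U zU; suff : F (zembed @^-1` U) by []; apply: filterS (FB U zU) => y
    [].
have FC : F C by apply: filterS (FB setT filterT) => y [].
have Fe e : 0 < e -> F [set y | forall k m, `|zb z k m - eb y k m| <= e].
  by move=> e0; apply: filterS (FB _ (zb_near z e0)) => y [].
have [k|y0 y0P] := zb_point (z := z).
  apply/eqP; rewrite -normr_eq0 eq_le normr_ge0 andbT.
  apply/ler_addgt0Pl => e e0; have [y /(_ k None)] := filter_ex (Fe e e0).
  by rewrite /= subr0 addr0.
have [D0 Ds _ _ _] := cd.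
have Fy0 e : 0 < e -> F [set y | d y0 y < e].
  move=> e0; have e20 : 0 < e / 2 by lra.
  (* At k = 1 and m = y0 the two coordinates are d y0 y0 = 0 and d y y0. *)
  apply: filterS (Fe _ e20) => y /(_ 1%g (Some y0)) /=.
  rewrite y0P !gact1 D0 sub0r normrN ger0_norm; last exact: cpmetric_ge0.
  by rewrite Ds; lra.
have [y1 Fy1] := pd FU Fy0.
exists y1; first exact: (ultra_closed_cvg _ cC FC Fy1).
have Fzy1 : zembed @ F --> zembed y1 by apply: continuous_cvg => //;
  exact: zembed_continuous.
exact: (cvg_unique (@zpt_hausdorff R G Y d) Fzy1 Fz).
Qed.

End Embedding.
End UniversalAction.

(** * The universal space is an equivariant extensor *)

Section UniversalExtension.
Context {R : realType} {G : topGroupType}.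
Hypothesis compactG : compact [set: G].
Hypothesis hausdorffG : hausdorff_space G.
Variables (A W : gspace G) (i : gmap A W) (H : set G).
Hypothesis ei : closed_embedding i.
Hypothesis pW : p_paracompact R W.

(** McShane's extension is only controlled by D. A sup-convolution with [delta] in the group
    variable restores the modulus required of [zc], and it changes nothing on A, where f already has
    this modulus. *)
Lemma compact_coordinate_extension (f : A -> G -> R) (delta : G -> G -> R) :
  cpmetric delta -> (forall k l g, delta (k * g)%g (l * g)%g = delta k l) ->
  (forall a k, 0 <= f a k <= 1) ->
  (forall k, continuous (f ^~ k)) ->
  (forall a k l, `|f a k - f a l| <= delta k l) ->
  (forall h a k, H h -> f (gact h a) k = f a (k * h)%g) ->
  exists F : W -> G -> R, [/\ (forall w k, 0 <= F w k <= 1),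
    (forall a k, F (i a) k = f a k),
    (forall h w k, H h -> F (gact h w) k = F w (k * h)%g),
    (forall w k l, `|F w k - F w l| <= delta k l) &
    (forall k w e, 0 < e -> \forall w' \near w, `|F w k - F w' k| <= e)].
Proof.
move=> cdelta deltaM f01 fc fdelta fH.
have [d0 ds dt d1 dc] := cdelta.
have [||F0 [D [cD F01 F0i F0H F0D]]] := equivariant_mcshane compactG hausdorffG
    ei pW (H := H) (M := unit) (f := fun _ => f) (fun _ => f01).
- move=> a k e e0; have e20 : 0 < e / 2 by lra.
  have /real_continuous/(_ a _ e20) aN := fc k.
  exists ([set a' | `|f a k - f a' k| < e / 2], [set k' | delta k k' < e / 2]).
    by split => //=; exact: dc.
  move=> [a' k'] [/= h1 h2] _; apply: (le_trans (ler_distD (f a' k) _ _)).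
  by have := fdelta a' k k'; lra.
- by move=> _ h a k Hh; rewrite fH// mulgVK.
pose F w k := supr (fun l => Num.max 0 (F0 tt w l - delta k l)).
have t01 w k l : 0 <= Num.max 0 (F0 tt w l - delta k l) <= 1.
  have := F01 tt w l; have := cpmetric_ge0 k l cdelta.
  by rewrite maxEle; case: ifP; lra.
have D0' w k l : `|F0 tt w k - F0 tt w l| <= 1.
  by have := F01 tt w k; have := F01 tt w l; rewrite ler_norml; lra.
exists F; split.
- by move=> w k; exact: supr_in01.
- move=> a k; apply/eqP; rewrite eq_le; apply/andP; split.
    apply: supr_le => [|l]; first by have /andP[] := f01 a k.
    rewrite F0i ge_max; have := fdelta a k l; have /andP[-> _] := f01 a k.
    by rewrite /= ler_norml; lra.
  have := @supr_ub _ _ (fun l => Num.max 0 (F0 tt (i a) l - delta k l)) k.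
  rewrite -/(F (i a) k) => /(_ _)h.
  have {h} : Num.max 0 (F0 tt (i a) k - delta k k) <= F (i a) k.
    by apply: h => l; have /andP[] := t01 (i a) k l.
  by rewrite ge_max d0 subr0 F0i => /andP[].
- move=> h w k Hh; rewrite /F /supr; congr sup; apply/seteqP;
    split=> _ [l _ <-].
    exists (l * h)%g => //; rewrite deltaM -(F0H tt h w (l * h)%g Hh).
    by rewrite mulgK.
  by exists (l * h^-1)%g => //; rewrite (F0H tt h w l Hh) -(deltaM _ _ h)
    mulgVK.
- move=> w k l; apply: supr_dist => //; first exact: cpmetric_ge0.
  move=> m; apply: max0_lipschitz; have := cpmetric_dist l k m cdelta.
  by rewrite (ds l k) !ler_norml; lra.
- move=> k w e e0.
  have cc := continuous_pair (@snd_continuous G W) (@fst_continuous G W).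
  have := cpmetric_near_compact w compactG cc cD e0.
  apply: filterS => w' ww'; apply: supr_dist => //; first exact: ltW.
  move=> l; apply: max0_lipschitz; have := ww' l; have := F0D tt w l w' l.
  by rewrite /= !ler_norml; lra.
Qed.

Variables (Y : gspace G) (d : Y -> Y -> R).

(* [Delta w] is 0 only if the extended coordinates at w are those of a point of
   A; adding it to the coordinate [None] keeps the values in the universal
   space. *)
Lemma zspace_extension (phi : A -> zspace d) :
  continuous phi -> (forall h a, H h -> phi (gact h a) = gact h (phi a)) ->
  exists Phi : W -> zspace d, [/\ continuous Phi, (forall a, Phi (i a) = phi a) &
    forall h w, H h -> Phi (gact h w) = gact h (Phi w)].
Proof.
move=> cphi phiH.
have [||F [D [cD F01 Fi FH FD]]] := equivariant_mcshane compactG hausdorffG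
    ei pW (H := H) (M := option Y) (f := fun m a k => zb (phi a) k m)
    (fun m a k => zb01 (phi a) k m).
- move=> a k e e0; have e20 : 0 < e / 2 by lra.
  exists ([set a' | forall k m, `|zb (phi a) k m - zb (phi a') k m| <= e / 2],
     [set k' | forall l m, `|zb (phi a) (l * k)%g m - zb (phi a) (l * k')%g m|
       <= e / 2]).
    by split => /=; [exact: (cphi a _ (zb_near (phi a) e20))|exact: zb_cont].
  move=> [a' k'] [/= h1 h2] m;
    apply: (le_trans (ler_distD (zb (phi a) k' m) _ _)).
  by have := h1 k' m; have := h2 1%g m; rewrite !mul1g; lra.
- by move=> m h a k Hh; rewrite phiH//= mulgVK.
have {}FH m h w k : H h -> F m (gact h w) k = F m w (k * h)%g.
  by move=> Hh; rewrite -(FH m h w (k * h)%g Hh) mulgK.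
have Fnear w e : 0 < e -> \forall w' \near w, forall m k, `|F m w k - F m w' k|
  < e.
  move=> e0.
  have cc := continuous_pair (@snd_continuous G W) (@fst_continuous G W).
  have := cpmetric_near_compact w compactG cc cD e0.
  by apply: filterS => w' ww' m k; apply: le_lt_trans (ww' k); exact: FD.
have Fcont w (g0 : G) e : 0 < e -> \forall g \near g0, forall m k,
    `|F m w (k * g0)%g - F m w (k * g)%g| < e.
  move=> e0; have cc : continuous (fun p : G * G => (w, (p.1 * p.2)%g)).
    by move=> p; apply: cvg_pair; [exact: cvg_cst|exact: mulg_continuous].
  have := cpmetric_near_compact g0 compactG cc cD e0.
  by apply: filterS => g h m k; apply: le_lt_trans (h k); exact: FD.
have [hW [dW0 [cdW0 pdW0]]] := paracompact_perfect_pm pW.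
pose dW := gsup dW0.
have cdW : cpmetric dW by exact: gsup_cpmetric.
have pdW : perfect_pm dW.
  by apply: perfect_pm_le pdW0 => x y; exact: gsup_ub.
pose diff w a (p : option Y * G) := `|F p.1 w p.2 - zb (phi a) p.2 p.1|.
have diff01 w a p : 0 <= diff w a p <= 1.
  rewrite normr_ge0 ler_norml; have := F01 p.1 w p.2.
  by have := zb01 (phi a) p.2 p.1; lra.
(* Measures both the distance of w from a in W and the discrepancy between the extended coordinates
   at w and those of [phi a]. *)
pose psi w a := Num.max (dW w (i a)) (supr (diff w a)).
have psi01 w a : 0 <= psi w a <= 1.
  have := cpmetric_in01 w (i a) cdW; have := supr_in01 (diff01 w a).
  by rewrite /psi maxEle; case: ifP; lra.
have psi'01 w a : 0 <= 1 - psi w a <= 1 by have := psi01 w a; lra.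
(* The infimum of [psi w] over A, written so that it is 1 when A is empty. *)
pose Delta w := 1 - supr (fun a => 1 - psi w a).
have Delta01 w : 0 <= Delta w <= 1.
  by have := supr_in01 (psi'01 w); rewrite /Delta; lra.
have psiH h w a : H h -> psi (gact h w) (gact h a) = psi w a.
  move=> Hh; rewrite /psi /dW gfun_equivariant gsup_act; congr Num.max.
  rewrite /supr; congr sup; apply/seteqP; split=> _ [[m k] _ <-] /=.
    by exists (m, (k * h)%g) => //; rewrite /diff /= FH// phiH.
  by exists (m, (k * h^-1)%g) => //; rewrite /diff /= FH// phiH//= mulgVK.
have DeltaH h w : H h -> Delta (gact h w) = Delta w.
  move=> Hh; rewrite /Delta /supr; congr (1 - sup _); apply/seteqP.
  split=> _ [a _ <-].
    by exists (gact h^-1%g a) => //; rewrite -(psiH h) ?gactVK.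
  by exists (gact h a) => //; rewrite psiH.
have Delta_i a : Delta (i a) = 0.
  have psi0 : psi (i a) a = 0.
    rewrite /psi; have [-> _ _ _ _] := cdW.
    have -> : supr (diff (i a) a) = 0; last by rewrite maxxx.
    apply/eqP; rewrite eq_le supr_ge0 ?andbT//; apply: supr_le => // p.
    by rewrite /diff Fi subrr normr0.
  have := @supr_ub _ _ (fun a' => 1 - psi (i a) a') a.
  rewrite psi0 subr0 => /(_ _)h; have := Delta01 (i a).
  have {h} : 1 <= supr (fun a' => 1 - psi (i a) a').
    by apply: h => a'; have /andP[] := psi'01 (i a) a'.
  by rewrite /Delta; lra.
have Delta_near w e : 0 < e -> \forall w' \near w, `|Delta w - Delta w'| <= e.
  move=> e0; have [_ _ _ _ dWc] := cdW.
  apply: filterS (filterI (dWc w e e0) (Fnear w e e0)) => w' [ww' FF].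
  rewrite /Delta opprB addrC addrA subrK distrC.
  rewrite -[X in `|X|]opprB normrN distrC.
  apply: supr_dist => //; first exact: ltW.
  move=> a; rewrite opprB addrC addrA subrK.
  have h1 := cpmetric_dist w w' (i a) cdW.
  have h2 : `|supr (diff w a) - supr (diff w' a)| <= e.
    apply: supr_dist => //; first exact: ltW.
    move=> p; have := FF p.1 p.2; have := ler_dist_dist (F p.1 w p.2 - zb
      (phi a) p.2 p.1)
      (F p.1 w' p.2 - zb (phi a) p.2 p.1).
    by rewrite opprB addrA subrK /diff; lra.
  move: h1 h2; rewrite /psi !ler_norml !maxEle.
  by case: ifP; case: ifP; rewrite ?leNgt; lra.
pose b w k m := if m is Some m then F (Some m) w k else Num.min 1 (F None w k +
  Delta w).
have b01 w k m : 0 <= b w k m <= 1.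
  case: m => [m|] /=; first exact: F01.
  have := F01 None w k; have := Delta01 w.
  by rewrite minEle; case: ifP; lra.
have min1_lip (x y e : R) : `|x - y| <= e -> `|Num.min 1 x - Num.min 1 y| <= e.
  by rewrite !ler_norml !minEle; case: ifP; case: ifP; rewrite ?leNgt; lra.
have b_near w e : 0 < e ->
    \forall w' \near w, forall k m, `|b w k m - b w' k m| <= e.
  move=> e0; have e20 : 0 < e / 2 by lra.
  apply: filterS (filterI (Fnear w _ e20) (Delta_near w _ e20)) => w' [FF DD] k.
  case=> [m|] /=; first by have := FF (Some m) k; lra.
  by apply: min1_lip; have := FF None k; move: DD; rewrite ltr_norml !ler_norml;
    lra.
have b_cont w (g0 : G) e : 0 < e -> \forall g \near g0, forall k m,
    `|b w (k * g0)%g m - b w (k * g)%g m| <= e.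
  move=> e0; apply: filterS (Fcont w g0 e e0) => g FF k [m|] /=;
    first exact: ltW.
  by apply: min1_lip; rewrite opprD addrACA subrr addr0; exact: ltW.
have b_i a k m : b (i a) k m = zb (phi a) k m.
  case: m => [m|] /=; rewrite ?Delta_i ?addr0 Fi//.
  by have := zb01 (phi a) k None; rewrite minEle; case: ifP => //;
    rewrite leNgt; lra.
have b_H h w k m : H h -> b (gact h w) k m = b w (k * h)%g m.
  by move=> Hh; case: m => [m|] /=; rewrite FH// DeltaH.
have b_point w : (forall k, b w k None = 0) ->
    exists y, forall k m, b w k (Some m) = d (gact k y) m.
  rewrite /b => b0.
  have [D0 F0] : Delta w = 0 /\ forall k, F None w k = 0.
    have H0 k : F None w k + Delta w = 0.
      by have := b0 k; have := F01 None w k; have := Delta01 w; rewrite minEle;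
        case: ifP; lra.
    split=> [|k]; first by have := H0 1%g; have := F01 None w 1%g; have :=
      Delta01 w; lra.
    by have := H0 k; have := F01 None w k; have := Delta01 w; lra.
  (* When Delta w = 0, some ultrafilter on A makes [psi w] tend to 0. Perfectness of [dW] and
     closedness of A yield a limit a0 in A. The point w need not be its image, but the extended
     coordinates at w agree with those of [phi a0], to which [zb_point] applies. *)
  have [|e /= e0|e e' e0 e0'|FF [FU FB]] := @ultra_separated A R
      [set e | 0 < e] (fun e => [set a | psi w a < e]).
  - by exists 1 => /=.
  - have [|||a ha] := @supr_gt R A (fun a => 1 - psi w a) (Num.max 0 (1 - e)).
    + by move=> a; have /andP[] := psi'01 w a.
    + by rewrite le_max lexx.
    + by rewrite gt_max; move: D0; rewrite /Delta => D0; apply/andP; split; lra.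
    + by exists a => /=; move: ha; rewrite gt_max => /andP[_]; lra.
  - exists (Num.min e e'); first by rewrite /= lt_min; apply/andP.
    by move=> a /=; rewrite lt_min => /andP[].
  have [|w' Fw'] := pdW w (i @ FF) (fmap_ultra i FU).
    move=> e e0; suff : FF [set a | dW w (i a) < e] by [].
    by apply: filterS (FB e e0) => a /=; rewrite /psi gt_max => /andP[].
  have [_ _ icl] := ei.
  have [a0 _ a0w'] : range i w'.
    apply: (ultra_closed_cvg _ (icl _ closedT) _ Fw').
    suff : FF [set a | range i (i a)] by [].
    by apply: filterE => a; exists a.
  have Fa0 : FF --> a0.
    move=> Q a0Q; have := closed_embedding_nbhs ei a0Q; rewrite a0w' => w'Q.
    have h : FF [set a | forall b, i b = i a -> Q b] := Fw' _ w'Q.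
    by apply: filterS h => a; exact.
  have bE k m : F m w k = zb (phi a0) k m.
    apply/eqP; rewrite -subr_eq0 -normr_eq0 eq_le normr_ge0 andbT.
    apply/ler_addgt0Pl => e e0; have e20 : 0 < e / 2 by lra.
    have h1 : FF [set a | forall k m, `|zb (phi a0) k m - zb (phi a) k m| <= e /
      2].
      exact: (Fa0 _ (cphi a0 _ (zb_near (phi a0) e20))).
    have [a [/= h2 h3]] := filter_ex (filterI h1 (FB _ e20)).
    have := @supr_ub _ _ (diff w a) (m, k) => /(_ _)h.
    have {h} : diff w a (m, k) <= supr (diff w a).
      by apply: h => p; have /andP[] := diff01 w a p.
    move: h3; rewrite /psi gt_max => /andP[_ h3]; rewrite /diff /= => h4.
    apply: (le_trans (ler_distD (zb (phi a) k m) _ _)).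
    by have := h2 k m; rewrite (distrC (zb (phi a0) k m)); lra.
  have [k|y yP] := zb_point (z := phi a0); first by rewrite -bE.
  by exists y => k m; rewrite bE yP.
have /choice[c cP] : forall q : @coordinate R G Y, exists C : W -> G -> R,
    [/\ (forall w k, 0 <= C w k <= 1), (forall a k, C (i a) k = zc (phi a) q k),
      (forall h w k, H h -> C (gact h w) k = C w (k * h)%g),
      (forall w k l, `|C w k - C w l| <= cmod q k l) &
      (forall k w e, 0 < e -> \forall w' \near w, `|C w k - C w' k| <= e)].
  move=> q; apply: compact_coordinate_extension.
  - exact: cmod_cpmetric.
  - exact: cmodM.
  - by move=> a k; exact: zc01.
  - move=> k; apply/real_continuous => a e e0; have e20 : 0 < e / 2 by lra.
    have h : \forall a' \near a, `|zc (phi a) q k - zc (phi a') q k| <= e / 2.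
      exact: (cphi a _ (zc_near (phi a) q k e20)).
    by apply: filterS h => a'; lra.
  - by move=> a k l; exact: zc_lip.
  - by move=> h a k Hh; rewrite phiH.
have c01 w q k : 0 <= c q w k <= 1 by have [] := cP q.
have c_lip w q k l : `|c q w k - c q w l| <= cmod q k l by have [] := cP q.
pose Phi w : zspace d := @ZPt R G Y d (b w) (fun q => c q w) (b01 w) (c01 w)
  (@b_cont w) (@b_point w) (c_lip w).
exists Phi; split.
- apply: zpt_continuous => [w e e0|q k w e e0] /=; first exact: b_near.
  by have [_ _ _ _] := cP q; apply.
- move=> a; apply: zpt_eq => [k m|q k] /=; first exact: b_i.
  by have [_ ci _ _ _] := cP q; exact: ci.
- move=> h w Hh; apply: zpt_eq => [k m|q k] /=; first exact: b_H.
  by have [_ _ cH _ _] := cP q; exact: cH.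
Qed.

End UniversalExtension.

(** * Equivariant extension and homotopy extension *)

Section SubLift.
Context {G : topGroupType} (X V : gspace G) (U : set X).
Variable Uinv : invariant_set U.

Lemma set_val_continuous (T : topologicalType) (A : set T) :
  continuous (set_val : A -> T).
Proof. exact: initial_continuous. Qed.

Lemma continuous_sub (T S : topologicalType) (A : set T) (f : S -> A) :
  continuous (fun s => set_val (f s)) -> continuous f.
Proof. by move=> cf; exact: (@continuous_comp_initial A S T set_val f). Qed.

Variable f : gmap V X.
Hypothesis fU : forall v, U (f v).

Let lift (v : V) : sub_gspace Uinv := SigSub (mem_set (fU v)).

Fact sub_lift_continuous : continuous lift.
Proof. by apply: continuous_sub => /=; exact: gfun_continuous. Qed.

Fact sub_lift_equivariant g v : lift (gact g v) = gact g (lift v).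
Proof. by apply: val_inj; rewrite /= gfun_equivariant. Qed.

Definition sub_lift : gmap V (sub_gspace Uinv) :=
  GMap sub_lift_continuous sub_lift_equivariant.

Definition sub_incl : gmap (sub_gspace Uinv) X.
Proof. by exists set_val => //; exact: set_val_continuous. Defined.

End SubLift.

Lemma closed_embedding_set_val (T : topologicalType) (A : set T) :
  closed A -> closed_embedding (set_val : A -> T).
Proof.
move=> cA; split; [exact: set_val_continuous|exact: val_inj|].
move=> C cC x xC; have Ax : A x.
  by apply: cA => B /xC[_ [[c _ <-] Bc]]; exists (set_val c); split => //;
    exact: set_valP.
exists (SigSub (mem_set Ax)) => //; apply: cC => B [_ [[O oO <-] Ox OB]].
have [_ [[c Cc <-] Oc]] := xC O (open_nbhs_nbhs (conj oO Ox)).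
by exists c; split => //; exact: OB.
Qed.

Section Extensor.
Context {R : realType} {G : topGroupType}.
Hypothesis compactG : compact [set: G].
Hypothesis hausdorffG : hausdorff_space G.

Definition equivariant_extensor (Z : gspace G) : Prop :=
  forall (A W : gspace G) (i : gmap A W) (H : set G) (phi : A -> Z),
    closed_embedding i -> p_paracompact R W -> continuous phi ->
    (forall h a, H h -> phi (gact h a) = gact h (phi a)) ->
    exists Phi : W -> Z, [/\ continuous Phi, (forall a, Phi (i a) = phi a) &
      forall h w, H h -> Phi (gact h w) = gact h (Phi w)].

Lemma embed_in_extensor (Y : gspace G) : p_paracompact R Y ->
  exists (Z : gspace G) (j : gmap Y Z),
    [/\ p_paracompact R Z, closed_embedding j & equivariant_extensor Z].
Proof.
move=> /paracompact_perfect_pm[hY [d [cd pd]]].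
exists (zspace d), (zembed compactG cd); split.
- exact: zpt_paracompact.
- exact: zembed_closed_embedding.
- by move=> A W i H phi ei pW cphi phiH; exact: zspace_extension.
Qed.

(** With Y embedded in an extensor Z, the map extends to W and is then retracted where its values
    lie in the neighbourhood U of Y. Testing O by G-maps [kappa] into it avoids a G-space structure
    on O and covers every smaller invariant set at once. *)
Lemma ganr_neighborhood_extension (Y A W : gspace G) (i : gmap A W)
    (phi : gmap A Y) :
  is_ganr R Y -> closed_embedding i -> p_paracompact R W ->
  exists O : set W, (forall a, nbhs (i a) O) /\
    forall (V : gspace G) (kappa : gmap V W), (forall v, O (kappa v)) ->
      exists psi : gmap V Y, forall v a, kappa v = i a -> psi v = phi a.
Proof.
move=> [pY Yr] ei pW; have [Z [j [pZ ej extZ]]] := embed_in_extensor pY.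
have [U [Uinv [r [nU rU]]]] := Yr Z j pZ ej.
have [|a|Phi [cPhi Phi_i PhiG]] :=
    extZ A W i setT (fun a => j (phi a)) ei pW _ _.
- by move=> x; apply: continuous_comp; exact: gfun_continuous.
- by move=> a' _; rewrite !gfun_equivariant.
exists (Phi @^-1` U); split=> [a|V kappa kU].
  by apply: cPhi; rewrite Phi_i; exact: nU.
pose Phim : gmap W Z := GMap cPhi (fun g w => PhiG g w I).
exists (gcomp r (sub_lift Uinv (f := gcomp Phim kappa) kU)) => v a va.
by apply: rU; transitivity (Phi (kappa v)) => //; rewrite va Phi_i.
Qed.

Lemma invariant_shrinking (A W : gspace G) (i : gmap A W) (O : set W) :
  closed_embedding i -> p_paracompact R W -> (forall a, nbhs (i a) O) ->
  exists u : W -> R, [/\ continuous u, (forall g w, u (gact g w) = u w),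
    (forall a, 0 < u (i a)) & forall w, 0 < u w -> O w].
Proof.
move=> ei pW nO.
have [|D [cD DE]] := @diag_nbhs_cpmetric _ _ pW (fun _ x y => range i x -> O y).
  move=> _ x; have [[a _ <-]|nx] := pselect (range i x).
    by exists O.
  exists (~` range i); first exact: closed_embedding_nbhsC.
  by move=> y z ny _ /ny.
have cD' := gsup_cpmetric compactG cD; pose D' := gsup D.
(* The threshold 1 / 2 is the bound at level 0 below which D forces w into O. *)
pose u w := supr (fun a => Num.max 0 (1 / 2 - D' (i a) w)).
have t01 w a : 0 <= Num.max 0 (1 / 2 - D' (i a) w) <= 1.
  by have := cpmetric_ge0 (i a) w cD'; rewrite -/D' maxEle; case: ifP; lra.
have [D0 Ds _ _ _] := cD'.
have Dact g x y : D' (gact g x) (gact g y) = D' x y := gsup_act D g x y.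
exists u; split.
- apply: (lipschitz_continuous cD') => x y; apply: supr_dist => //.
    exact: cpmetric_ge0.
  move=> a; apply: max0_lipschitz; have := cpmetric_dist x y (i a) cD'.
  by rewrite (Ds x) (Ds y (i a)) -/D' !ler_norml; lra.
- move=> g w; rewrite /u /supr; congr sup; apply/seteqP; split=> _ [a _ <-].
    by exists (gact g^-1%g a) => //; rewrite -(Dact g _ w) -gfun_equivariant
      gactVK.
  by exists (gact g a) => //; rewrite gfun_equivariant Dact.
- move=> a; apply: (@lt_le_trans _ _ (1 / 2)); first lra.
  have := @supr_ub _ _ (fun b => Num.max 0 (1 / 2 - D' (i b) (i a))) a.
  rewrite -/(u (i a)) /D' D0 subr0 => /(_ _)h.
  have {h} : Num.max 0 (1 / 2) <= u (i a).
    by apply: h => b; have /andP[] := t01 (i a) b.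
  by rewrite ge_max => /andP[].
- move=> w uw; have [||a ha] := @supr_gt R A (fun a => Num.max 0
    (1 / 2 - D' (i a) w)) 0 _ _ uw.
  + by move=> a; have /andP[] := t01 w a.
  + by [].
  move: ha; rewrite lt_max ltxx /= => ha.
  apply: (DE 0%N (i a) w); last by exists a.
  rewrite expr1; have := gsup_ub (i a) w cD; rewrite -/D'; lra.
Qed.

End Extensor.

(** * Equivariant homotopies *)

Section Homotopy.
Context {R : realType} {G : topGroupType}.
Implicit Types X Y Z : gspace G.

Definition clamp (t : R) : R := Num.max 0 (Num.min 1 t).

Lemma clamp01 t : 0 <= clamp t <= 1.
Proof. by rewrite /clamp le_max lexx ge_max ler01 ge_min lexx. Qed.

Lemma clamp_le0 t : t <= 0 -> clamp t = 0.
Proof. by move=> t0; rewrite /clamp max_l// ge_min t0 orbT. Qed.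

Lemma clamp_ge1 t : 1 <= t -> clamp t = 1.
Proof. by move=> t1; rewrite /clamp min_l// max_r. Qed.

Lemma near_dist (t e : R) : 0 < e -> \forall s \near t, `|t - s| < e.
Proof. exact: nbhsx_ballx. Qed.

Lemma clamp_continuous : continuous clamp.
Proof.
apply/real_continuous => t e e0.
apply: filterS (near_dist t e0) => s; apply: le_lt_trans.
have h1 := ler_norm (t - s); have h2 := ler_norm (s - t).
rewrite (distrC s t) in h2; move: h1 h2; set d := `|t - s| => h1 h2.
rewrite ler_norml /clamp !maxEle !minEle.
by do 4?[case: ifP]; rewrite ?leNgt; lra.
Qed.

Lemma clamp_pair_continuous (X : topologicalType) :
  continuous (fun p : X * R => (p.1, clamp p.2)).
Proof.
apply: continuous_pair; first exact: fst_continuous.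
apply: continuous_comp_fun; first exact: snd_continuous.
exact: clamp_continuous.
Qed.

(* A homotopy on X * R that is stationary outside [0, 1]: such homotopies can
   be glued along open sets. *)
Definition ghomotopicR X Y (f0 f1 : gmap X Y) : Prop :=
  exists F : X * R -> Y, [/\ continuous F,
    (forall g x t, F (gact g x, t) = gact g (F (x, t))),
    (forall x t, t <= 0 -> F (x, t) = f0 x) &
    (forall x t, 1 <= t -> F (x, t) = f1 x)].

Lemma ghomotopicRP X Y (f0 f1 : gmap X Y) :
  ghomotopic R f0 f1 <-> ghomotopicR f0 f1.
Proof.
split=> [[F [cF FG F0 F1]]|[F [cF FG F0 F1]]]; last first.
  exists F; split => //; first exact: (continuous_subspaceT cF).
  - by move=> x; rewrite F0.
  - by move=> x; rewrite F1.
have inS (p : X * R) : (p.1, clamp p.2) \in [set: X] `*` `[0, 1].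
  by apply/mem_set; split => //=; rewrite in_itv/= clamp01.
pose lift (p : X * R) : ([set: X] `*` `[0, 1] : set (X * R)) := SigSub (inS p).
exists (fun p => F (p.1, clamp p.2)); split.
- have clift : continuous lift.
    by apply: continuous_sub => /=; exact: clamp_pair_continuous.
  have /subspace_sigL_continuousP csF := cF.
  move=> p; apply: (@continuous_comp _ _ _ lift
    (sigL ([set: X] `*` `[0, 1] : set (X * R)) F) p); [exact: clift|exact: csF].
- by move=> g x t; rewrite FG//= in_itv/= clamp01.
- by move=> x t t0; rewrite clamp_le0.
- by move=> x t t1; rewrite clamp_ge1.
Qed.

Lemma ghomotopic_eq X Y (f0 f1 : gmap X Y) : f0 =1 f1 -> ghomotopic R f0 f1.
Proof.
move=> f01; apply/ghomotopicRP; exists (fun p => f0 p.1); split=> //.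
- by apply: continuous_comp_fun; [exact: fst_continuous|exact: gfun_continuous].
- by move=> g x t; rewrite gfun_equivariant.
Qed.

Lemma affine_continuous (X : topologicalType) (a b : R) :
  continuous (fun p : X * R => (p.1, a * p.2 + b)).
Proof.
apply: continuous_pair; first exact: fst_continuous.
apply: (@continuous_comp_fun _ _ _ snd (fun t : R => a * t + b)).
  exact: snd_continuous.
apply/real_continuous => t e e0.
have a0 : 0 < `|a| + 1 by have := normr_ge0 a; lra.
apply: filterS (near_dist t (divr_gt0 e0 a0)) => s; rewrite ltr_pdivlMr// => ts.
have -> : a * t + b - (a * s + b) = a * (t - s) by lra.
rewrite normrM; apply: le_lt_trans ts; rewrite mulrC ler_wpM2l//; lra.
Qed.

Lemma ghomotopic_sym X Y (f0 f1 : gmap X Y) :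
  ghomotopic R f0 f1 -> ghomotopic R f1 f0.
Proof.
move=> /ghomotopicRP[F [cF FG F0 F1]]; apply/ghomotopicRP.
exists (fun p => F (p.1, -1 * p.2 + 1)); split.
- by apply: continuous_comp_fun cF; exact: affine_continuous.
- by move=> g x t; rewrite FG.
- by move=> x t t0; rewrite F1//=; lra.
- by move=> x t t1; rewrite F0//=; lra.
Qed.

Lemma continuous_near_eq (T U : topologicalType) (f g : T -> U) (x : T) :
  (\forall y \near x, f y = g y) -> {for x, continuous g} ->
    {for x, continuous f}.
Proof.
move=> fg cg A; rewrite (nbhs_singleton fg) => /cg gA.
have gA' : \forall y \near x, A (g y) := gA.
by apply: filterS (filterI fg gA') => y [/= <-].
Qed.

Lemma near_snd_lt (X : topologicalType) (p : X * R) c : p.2 < c ->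
  \forall p' \near p, p'.2 < c.
Proof.
move=> pc; have e0 : 0 < c - p.2 by lra.
exists (setT, [set t | `|p.2 - t| < c - p.2]).
  by split; [exact: filterT|exact: near_dist].
by move=> [x t] [_]; rewrite /= ltr_norml; lra.
Qed.

Lemma near_snd_gt (X : topologicalType) (p : X * R) c : c < p.2 ->
  \forall p' \near p, c < p'.2.
Proof.
move=> pc; have e0 : 0 < p.2 - c by lra.
exists (setT, [set t | `|p.2 - t| < p.2 - c]).
  by split; [exact: filterT|exact: near_dist].
by move=> [x t] [_]; rewrite /= ltr_norml; lra.
Qed.

Lemma ghomotopic_trans X Y (f1 f0 f2 : gmap X Y) :
  ghomotopic R f0 f1 -> ghomotopic R f1 f2 -> ghomotopic R f0 f2.
Proof.
move=> /ghomotopicRP[F [cF FG F0 F1]] /ghomotopicRP[F' [cF' FG' F0' F1']].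
apply/ghomotopicRP.
(* The homotopies run during [0, 1/3] and [2/3, 1]. Both are f1 in between, so they agree on an open
   set around the seam at 1/2. *)
pose K p := F (p.1, 3 * p.2 + 0); pose K' p := F' (p.1, 3 * p.2 + -2).
have cK : continuous K.
  by apply: continuous_comp_fun cF; exact: affine_continuous.
have cK' : continuous K'.
  by apply: continuous_comp_fun cF'; exact: affine_continuous.
exists (fun p => if p.2 <= 1 / 2 then K p else K' p); split.
- move=> p; have [p2|p2] := ltP p.2 (2 / 3).
    apply: (@continuous_near_eq _ _ _ K); last exact: cK.
    apply: filterS (near_snd_lt p2) => p' p'2; case: ifP => // /negbT.
    by rewrite -ltNge => h; rewrite /K /K' F1 ?F0'//; lra.
  apply: (@continuous_near_eq _ _ _ K'); last exact: cK'.
  have p3 : 1 / 2 < p.2 by lra.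
  apply: filterS (near_snd_gt p3) => p' p'2; case: ifP => //.
  by rewrite leNgt p'2.
- by move=> g x t /=; case: ifP => _; [exact: FG|exact: FG'].
- move=> x t t0 /=; have -> : t <= 1 / 2 by lra.
  by rewrite /K F0//=; lra.
- move=> x t t1 /=; have -> : (t <= 1 / 2) = false by apply/negbTE;
    rewrite -ltNge; lra.
  by rewrite /K' F1'//=; lra.
Qed.

Lemma ghomotopic_compl X Y Z (k : gmap Y Z) (f0 f1 : gmap X Y) :
  ghomotopic R f0 f1 -> ghomotopic R (gcomp k f0) (gcomp k f1).
Proof.
move=> /ghomotopicRP[F [cF FG F0 F1]]; apply/ghomotopicRP.
exists (fun p => k (F p)); split.
- by apply: continuous_comp_fun cF _; exact: gfun_continuous.
- by move=> g x t; rewrite FG gfun_equivariant.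
- by move=> x t t0; rewrite F0.
- by move=> x t t1; rewrite F1.
Qed.

Lemma ghomotopic_compr X Y Z (f0 f1 : gmap Y Z) (k : gmap X Y) :
  ghomotopic R f0 f1 -> ghomotopic R (gcomp f0 k) (gcomp f1 k).
Proof.
move=> /ghomotopicRP[F [cF FG F0 F1]]; apply/ghomotopicRP.
exists (fun p => F (k p.1, p.2)); split.
- apply: (@continuous_comp_fun _ _ _ (fun p : X * R => (k p.1, p.2)) F) => //.
  apply: continuous_pair; last exact: snd_continuous.
  by apply: continuous_comp_fun; [exact: fst_continuous|exact: gfun_continuous].
- by move=> g x t; rewrite gfun_equivariant FG.
- by move=> x t t0; rewrite F0.
- by move=> x t t1; rewrite F1.
Qed.

End Homotopy.

Arguments ghomotopic_trans {R G X Y} f1 {f0 f2}.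

Section HomotopyExtension.
Context {R : realType} {G : topGroupType}.
Hypothesis compactG : compact [set: G].
Hypothesis hausdorffG : hausdorff_space G.

Lemma closed_nbhsC (T : topologicalType) (C : set T) :
  (forall x, ~ C x -> nbhs x (~` C)) -> closed C.
Proof.
move=> nC x xC; apply: contrapT => /nC/xC[y [Cy nCy]]; exact: nCy.
Qed.

(** Neighbourhood extension is applied in W x R to the closed invariant set C consisting of the
    times t <= 0 and t >= 1 together with A x R. *)
Lemma ganr_homotopy_extension (Y A W : gspace G) (i : gmap A W)
    (phi0 phi1 : gmap W Y) :
  is_ganr R Y -> closed_embedding i -> p_paracompact R W ->
  ghomotopic R (gcomp phi0 i) (gcomp phi1 i) ->
  exists O : set W, (forall a, nbhs (i a) O) /\
    forall (V : gspace G) (kappa : gmap V W), (forall v, O (kappa v)) ->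
      ghomotopic R (gcomp phi0 kappa) (gcomp phi1 kappa).
Proof.
move=> rY ei pW /ghomotopicRP[F [cF FG F0 F1]]; have [ci ii icl] := ei.
pose WR := prod_gspace W (trivial_gspace G R).
have pWR : p_paracompact R WR.
  by apply: p_paracompact_prod => //; exact: p_paracompact_real.
pose C : set WR := [set p | p.2 <= 0 \/ 1 <= p.2 \/ range i p.1].
have clC : closed C.
  apply: closed_nbhsC => p; rewrite /C /= => /not_orP[p0 /not_orP[p1 pi]].
  have {}p0 : 0 < p.2 by rewrite ltNge; apply/negP.
  have {}p1 : p.2 < 1 by rewrite ltNge; apply/negP.
  have pN : nbhs p [set p' | ~ range i p'.1].
    exists ([set w | ~ range i w], setT); last by move=> [? ?] [].
    by split; [exact: closed_embedding_nbhsC|exact: filterT].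
  apply: filterS (filterI pN (filterI (near_snd_gt p0) (near_snd_lt p1))).
  by move=> p' [/= np' [p'0 p'1]] [|[|//]]; lra.
have Cinv : invariant_set C.
  move=> g p [?|[?|[a _ pa]]]; [by left|by right; left|right; right].
  by exists (gact g a) => //; rewrite gfun_equivariant /= -pa.
(* The homotopy on A is run during [1/3, 2/3], so near times 0 and 1 the map is [phi0] or [phi1] on
   open sets, which gives continuity where the pieces of C meet. The final default is only taken
   outside C. *)
pose k (p : W * R) : Y := if p.2 < 1 / 3 then phi0 p.1
  else if 2 / 3 < p.2 then phi1 p.1
  else if pselect (exists a, i a = p.1) is left e
  then F (projT1 (cid e), 3 * p.2 + -1) else phi0 p.1.
have kF a p : i a = p.1 -> k p = F (a, 3 * p.2 + -1).
  rewrite /k => ap; case: ifP => [p3|/negbT]; first by rewrite F0 /= ?ap//; lra.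
  rewrite -leNgt => p3; case: ifP => [p3'|_]; first by rewrite F1 /= ?ap//; lra.
  case: pselect => [e|]; last by case; exists a.
  by case: cid => b /=; rewrite -ap => /ii ->.
have k0 p : p.2 < 1 / 3 -> k p = phi0 p.1 by rewrite /k => ->.
have k1 p : 2 / 3 < p.2 -> k p = phi1 p.1.
  by rewrite /k => p3; rewrite p3 ifF//; apply/negbTE; rewrite -leNgt; lra.
have Ci p : C p -> 0 < p.2 < 1 -> exists a, i a = p.1.
  by move=> [|[|[a _ pa]]]; [lra|lra|exists a].
pose AR := sub_gspace Cinv; pose iR : gmap AR WR := sub_incl Cinv.
have cs : continuous (fun p : AR => (set_val p : WR).1).
  by apply: (continuous_comp_fun (@set_val_continuous _ C));
    exact: fst_continuous.
have sn : continuous (set_val : AR -> WR) by exact: set_val_continuous.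
have ck : continuous (fun p : AR => k (set_val p)).
  move=> p; have Cp : C (set_val p) := set_valP p.
  have [p3|p3] := ltP (set_val p : WR).2 (1 / 3).
    apply: (@continuous_near_eq _ _ _ (fun p : AR => phi0 (set_val p : WR).1)).
      have h : \forall p' \near p, (set_val p' : WR).2 < 1 / 3.
        exact: (sn p _ (near_snd_lt p3)).
      by apply: filterS h => p'; exact: k0.
    by apply: (continuous_comp_fun cs); exact: gfun_continuous.
  have [p3'|p3'] := ltP (2 / 3) (set_val p : WR).2.
    apply: (@continuous_near_eq _ _ _ (fun p : AR => phi1 (set_val p : WR).1)).
      have h : \forall p' \near p, 2 / 3 < (set_val p' : WR).2.
        exact: (sn p _ (near_snd_gt p3')).
      by apply: filterS h => p'; exact: k1.
    by apply: (continuous_comp_fun cs); exact: gfun_continuous.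
  have p01 : 0 < (set_val p : WR).2 < 1 by lra.
  have [a ap] := Ci _ Cp p01; have /andP[p0 p1] := p01.
  move=> Q; rewrite (kF a)// => FQ.
  have cF' : continuous (fun q : A * R => F (q.1, 3 * q.2 + -1)).
    by apply: continuous_comp_fun cF; exact: affine_continuous.
  have [[Q1 Q2] [/= aQ1 pQ2] QQ] := cF' (a, (set_val p : WR).2) _ FQ.
  have N1 := closed_embedding_nbhs ei aQ1; rewrite ap in N1.
  have h1 : \forall p' \near p, forall b, i b = (set_val p' : WR).1 -> Q1 b.
    exact: (cs p _ N1).
  have cs2 : continuous (fun p : AR => (set_val p : WR).2).
    by apply: (continuous_comp_fun sn); exact: snd_continuous.
  have h2 : \forall p' \near p, Q2 (set_val p' : WR).2 by exact: (cs2 p _ pQ2).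
  have h3 : \forall p' \near p, 0 < (set_val p' : WR).2 by exact: (sn p _
    (near_snd_gt p0)).
  have h4 : \forall p' \near p, (set_val p' : WR).2 < 1 by exact: (sn p _
    (near_snd_lt p1)).
  apply: filterS (filterI (filterI h1 h2) (filterI h3 h4)).
  move=> p' [[/= p'Q1 p'Q2] [p'0 p'1]].
  have [|a' a'p'] := Ci _ (set_valP p' : C (set_val p')); first by rewrite p'0.
  by rewrite /= (kF a')//; apply: (QQ (a', _)); split => //=; exact: p'Q1.
have kG g (p : AR) : k (set_val (gact g p)) = gact g (k (set_val p)).
  have Cp : C (set_val p) := set_valP p.
  have -> : set_val (gact g p) = (gact g (set_val p : WR).1, (set_val p : WR).2)
    by [].
  move: (set_val p) Cp => [w t] Cwt /=.
  have [t3|t3] := ltP t (1 / 3); first by rewrite !k0//= gfun_equivariant.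
  have [t3'|t3'] := ltP (2 / 3) t; first by rewrite !k1//= gfun_equivariant.
  have [|a /= aw] := Ci _ Cwt; first by rewrite /=; lra.
  rewrite (kF a (w, t))// (kF (gact g a) (gact g w, t)) /= ?FG//.
  by rewrite gfun_equivariant aw.
pose phi : gmap AR Y := GMap ck kG.
have eiR : closed_embedding iR by exact: closed_embedding_set_val.
have [O' [nO' O'P]] :=
  ganr_neighborhood_extension compactG hausdorffG phi rY eiR pWR.
have nO'C p : C p -> nbhs p O'.
  by move=> Cp; exact: (nO' (SigSub (mem_set Cp))).
(* A neighbourhood of A because [0, 1] is compact; clamping the time then keeps V x R inside O'. *)
exists [set w | forall t, 0 <= t <= 1 -> O' (w, t)]; split=> [a|V kappa kO].
  have /compact_near_coveringP cI := @normed_module.segment_compact R 0 1.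
  have := cI W (nbhs (i a)) (fun w t => O' (w, t)) _ => /(_ _)h.
  have {}h : \forall w \near i a, `[0, 1]%classic `<=` (fun t => O' (w, t)).
    apply: h => t _; have [|[N1 N2] [/= aN1 tN2] NN] := nO'C (i a, t).
      by right; right; exists a.
    by exists (N2, N1) => // -[t' w] [/= ? ?]; exact: NN.
  by apply: filterS h => w wO t t01; apply: wO; rewrite /= in_itv.
pose VR := prod_gspace V (trivial_gspace G R).
have ckR : continuous (fun p : VR => (kappa p.1, clamp p.2) : WR).
  apply: continuous_pair.
    by apply: continuous_comp_fun;
      [exact: fst_continuous|exact: gfun_continuous].
  by apply: continuous_comp_fun;
    [exact: snd_continuous|exact: clamp_continuous].
have kRG (g : G) (p : VR) : ((kappa (gact g p).1, clamp (gact g p).2) : WR) =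
    gact g ((kappa p.1, clamp p.2) : WR).
  by rewrite /= /prod_act /= gfun_equivariant.
pose kR : gmap VR WR := GMap ckR kRG.
have [p|psi psiP] := O'P VR kR; first by apply: kO; exact: clamp01.
apply/ghomotopicRP; exists psi; split.
- exact: (@gfun_continuous _ _ _ psi).
- by move=> g x t; exact: (gfun_equivariant psi g (x, t)).
- move=> x t t0; have Cx : C (kappa x, 0) by left.
  rewrite (psiP (x, t) (SigSub (mem_set Cx))) /= ?clamp_le0//.
  by rewrite k0//=; lra.
- move=> x t t1; have Cx : C (kappa x, 1) by right; left.
  rewrite (psiP (x, t) (SigSub (mem_set Cx))) /= ?clamp_ge1//.
  by rewrite k1//=; lra.
Qed.

End HomotopyExtension.

(** * Neighbourhood systems and their fixed points *)

Lemma near_subspace (T : topologicalType) (A : set T) (s : A) (Q : set A) :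
  nbhs s Q -> \forall x \near set_val s, forall b : A, set_val b = x -> Q b.
Proof.
move=> [_ [[O oO <-] Os OQ]].
by apply: filterS (open_nbhs_nbhs (conj oO Os)) => x Ox b bx; apply: OQ;
  rewrite /= bx.
Qed.
Lemma closed_embedding_comp (S T U : topologicalType) (f : S -> T)
    (g : T -> U) :
  closed_embedding f -> closed_embedding g ->
  closed_embedding (fun x => g (f x)).
Proof.
move=> [cf fi fcl] [cg gi gcl]; split.
- exact: continuous_comp_fun.
- by move=> x y /gi/fi.
- by move=> C cC; rewrite -(image_comp f g); apply/gcl/fcl.
Qed.

Lemma closed_embedding_sub (S T : topologicalType) (A : set T) (f : S -> A) :
  closed_embedding (fun x => set_val (f x)) -> closed_embedding f.
Proof.
move=> [cf fi fcl]; split; first exact: continuous_sub.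
  by move=> x y xy; apply: fi; rewrite xy.
move=> C cC; have -> : f @` C = set_val @^-1` ((fun x => set_val (f x)) @` C).
  by apply/seteqP; split=> y [x Cx xy]; exists x => //;
    [rewrite xy|exact: val_inj].
apply: preimage_closed; last exact: fcl.
by move=> x _; exact: set_val_continuous.
Qed.

Lemma near_gt0 (R : realType) (T : topologicalType) (u : T -> R) (x : T) :
  continuous u -> 0 < u x -> \forall y \near x, 0 < u y.
Proof.
move=> /real_continuous cu ux; apply: filterS (cu x _ ux) => y.
by rewrite ltr_norml; lra.
Qed.

(** Adding the variation of u to the pseudometric keeps limits inside S: if the new distance from s
    tends to 0, the limit x has u x = u s > 0. *)
Lemma p_paracompact_cozero (R : realType) (T : topologicalType) (u : T -> R)
    (C S : set T) :
  p_paracompact R T -> continuous u -> closed C ->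
  (forall x, S x <-> C x /\ 0 < u x) -> p_paracompact R S.
Proof.
move=> /paracompact_perfect_pm[hT [D [cD pD]]] cu cC SE.
have cu1 : cpmetric (fun x y : T => Num.min 1 `|u x - u y|).
  apply: cpmetric_min1.
  - by move=> x; rewrite subrr normr0.
  - by move=> x y; rewrite distrC.
  - by move=> x y z; exact: ler_distD.
  - by move=> x e e0; move: cu => /real_continuous cu; exact: cu.
pose D' (s t : S) := Num.max (D (set_val s) (set_val t))
  (Num.min 1 `|u (set_val s) - u (set_val t)|).
apply: (@perfect_pm_paracompact _ _ D').
- exact: hausdorff_continuous_inj (@set_val_continuous _ S) val_inj hT.
- apply: cpmetric_max; first exact: cpmetric_comp (@set_val_continuous _ S) cD.
  exact: cpmetric_comp (@set_val_continuous _ S) cu1.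
- move=> s F FU Fs.
  have [|x Fx] := pD (set_val s) _ (fmap_ultra set_val FU).
    move=> e e0; suff : F [set t | D (set_val s) (set_val t) < e] by [].
    by apply: filterS (Fs e e0) => t; rewrite /= gt_max => /andP[].
  have sE (y : S) : C (set_val y) /\ 0 < u (set_val y) by apply/SE;
    exact: (set_valP y).
  have Cx : C x.
    apply: (ultra_closed_cvg _ cC _ Fx).
    suff : F [set t | C (set_val t)] by [].
    by apply: filterE => t; have [] := sE t.
  have ux : u x = u (set_val s).
    apply/eqP; rewrite -subr_eq0 -normr_eq0 eq_le normr_ge0 andbT.
    apply/ler_addgt0Pl => e e0; have e20 : 0 < e / 2 by lra.
    have /real_continuous/(_ x _ e20) uN := cu.
    have h1 : F [set t | `|u x - u (set_val t)| < e / 2] := Fx _ uN.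
    have m0 : 0 < Num.min 1 (e / 2) by rewrite lt_min ltr01.
    have [t [/= h2]] := filter_ex (filterI h1 (Fs _ m0)).
    rewrite /D' gt_max => /andP[_]; rewrite lt_min !gt_min ltxx /= => /andP[m1
      m2].
    have : `|u (set_val s) - u (set_val t)| < e / 2.
      by case/orP: m2 => // m2; exact: lt_trans m1 m2.
    have := ler_distD (u (set_val t)) (u x) (u (set_val s)).
    by rewrite (distrC (u (set_val t))); lra.
  have Sx : S x by apply/SE; rewrite ux; split=> //; have [] := sE s.
  exists (SigSub (mem_set Sx)) => Q /near_subspace xQ.
  have h : F [set t | forall b : S, set_val b = set_val t -> Q b] := Fx _ xQ.
  by apply: filterS h => t; exact.
Qed.

Section FixedPoints.
Context {G : topGroupType}.

Lemma fixed_points_closed (X : gspace G) (H : set G) :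
  hausdorff_space X -> closed (fixed_points X H).
Proof.
move=> hX x xH h Hh; apply: hX => A B hxA xB.
have hA : nbhs x (gact h @^-1` A) := gact_continuousr hxA.
have [y [yH [hyA yB]]] := xH _ (filterI hA xB).
by exists y; split => //; rewrite -(yH h Hh).
Qed.

End FixedPoints.

Lemma trivial_group_compact : compact [set: trivial_group].
Proof.
have -> : [set: trivial_group] = [set (tt : trivial_group)].
  by apply/seteqP; split=> -[].
exact: compact_set1.
Qed.

Lemma trivial_group_hausdorff : hausdorff_space trivial_group.
Proof. by move=> [] []. Qed.

Lemma trivial_group_act (X : gspace trivial_group) (g : trivial_group) (x : X) :
  gact g x = x.
Proof. by case: g; exact: gact1. Qed.

Definition trivial_gmap (G : topGroupType) (S T : topologicalType) (f : S -> T)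
  (cf : continuous f) : gmap (trivial_gspace G S) (trivial_gspace G T) :=
  @GMap G (trivial_gspace G S) (trivial_gspace G T) f cf (fun _ _ => erefl).

Section MovableFixedPoints.
Context {R : realType} {G : topGroupType}.
Hypothesis compactG : compact [set: G].
Hypothesis hausdorffG : hausdorff_space G.
Variables (X Z : gspace G) (j : gmap X Z) (H : set G).
Hypothesis ej : closed_embedding j.
Hypothesis pZ : p_paracompact R Z.
Hypothesis extZ : @equivariant_extensor R G Z.

(** Neighbourhoods are given by functions because cozero sets stay p-paracompact, whereas an open
    subset of even a compact Hausdorff space may fail to be paracompact. *)
Record nbhd_fun := NbhdFun {
  nfun :> Z -> R;
  nfun_continuous : continuous nfun;
  nfun_act : forall g z, nfun (gact g z) = nfun z;
  nfun_gt0 : forall x, 0 < nfun (j x)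
}.

Definition nle (u v : nbhd_fun) : Prop := forall z, 0 < v z -> 0 < u z.

Lemma nle_trans u v w : nle u v -> nle v w -> nle u w.
Proof. by move=> uv vw z /vw/uv. Qed.

Definition nbhd (u : nbhd_fun) : set Z := [set z | 0 < u z].

Lemma nbhd_inv u : invariant_set (nbhd u).
Proof. by move=> g z; rewrite /nbhd /= nfun_act. Qed.

Local Notation Ug u := (sub_gspace (@nbhd_inv u)).

Definition nbhd_incl u v (uv : nle u v) : gmap (Ug v) (Ug u).
Proof.
apply: (sub_lift (@nbhd_inv u) (f := sub_incl (@nbhd_inv v))) => s.
by apply: uv; exact: (set_valP s).
Defined.

Definition nbhd_point u : gmap X (Ug u) := sub_lift (@nbhd_inv u) (@nfun_gt0 u).

Lemma nbhd_min (u v : nbhd_fun) : exists w, nle u w /\ nle v w.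
Proof.
have cm : continuous (fun z => Num.min (u z) (v z)).
  apply/real_continuous => z e e0.
  have /real_continuous/(_ z e e0) uN := @nfun_continuous u.
  have /real_continuous/(_ z e e0) vN := @nfun_continuous v.
  apply: filterS (filterI uN vN) => y []; rewrite !ltr_norml !minEle.
  by case: ifP; case: ifP; rewrite ?leNgt; lra.
have am g z : Num.min (u (gact g z)) (v (gact g z)) = Num.min (u z) (v z).
  by rewrite !nfun_act.
have gm x : 0 < Num.min (u (j x)) (v (j x)) by rewrite lt_min !nfun_gt0.
exists (NbhdFun cm am gm).
by split=> z /=; rewrite lt_min => /andP[].
Qed.

Lemma nbhd_shrinking (O : set Z) : (forall x, nbhs (j x) O) ->
  exists u, forall z, nbhd u z -> O z.
Proof.
move=> nO; have [u [cu uG uj uO]] := invariant_shrinking compactG ej pZ nO.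
by exists (NbhdFun cu uG uj).
Qed.

Lemma nbhd_paracompact u : p_paracompact R (Ug u).
Proof.
apply: (p_paracompact_cozero pZ (@nfun_continuous u) closedT) => z.
by split=> [|[]].
Qed.

Lemma nbhd_ganr u : is_ganr R (Ug u).
Proof.
split=> [|W i pW ei]; first exact: nbhd_paracompact.
have [|//|Phi [cPhi Phi_i PhiG]] := extZ (A := Ug u) (H := setT) (phi :=
  set_val) ei pW.
  exact: set_val_continuous.
pose Phim : gmap W Z := GMap cPhi (fun g w => PhiG g w I).
pose U := [set w : W | 0 < u (Phi w)].
have Uinv : invariant_set U by move=> g w; rewrite /U /= PhiG// nfun_act.
have UP (s : sub_gspace Uinv) : nbhd u (gcomp Phim (sub_incl Uinv) s).
  exact: (set_valP s).
exists U, Uinv, (sub_lift (@nbhd_inv u) UP); split=> [y|y s sy].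
  apply: (@near_gt0 _ _ (fun w => u (Phi w))).
    by apply: (continuous_comp_fun cPhi); exact: nfun_continuous.
  by rewrite Phi_i; exact: (set_valP y).
apply: val_inj; transitivity (Phi (set_val s)) => //.
by rewrite sy Phi_i.
Qed.

Lemma nbhd_point_closed_embedding u : closed_embedding (nbhd_point u).
Proof. by apply: closed_embedding_sub; exact: ej. Qed.

(** A movability index a' of the system S determines v before w is known: v maps to the term a',
    movability leads from a' to a term b' that depends on w, and that term maps back into w. *)
Lemma nbhd_movable : gmovable R X ->
  forall u, exists v (uv : nle u v), forall w (uw : nle u w),
    exists r : gmap (Ug v) (Ug w),
      ghomotopic R (gcomp (nbhd_incl uw) r) (nbhd_incl uv).
Proof.
move=> [S [Sanr Smov [p [pS pK]]]] u.
have [a [f jf]] := (pK _ (nbhd_ganr u)).1 (nbhd_point u).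
have [a' [aa' a'mov]] := Smov a.
(* The projection [p a'] extends from X to a G-map q on a neighbourhood v0. *)
have [O1 [nO1 O1P]] :=
  ganr_neighborhood_extension compactG hausdorffG (p a') (Sanr a') ej pZ.
have [v1 v1O] := nbhd_shrinking nO1.
have [v0 [uv0 v1v0]] := nbhd_min u v1.
have [|q qP] := O1P _ (sub_incl (@nbhd_inv v0)).
  by move=> s; apply/v1O/v1v0; exact: (set_valP s).
(* On X the route through the term a' is homotopic to the inclusion into u; the homotopy spreads to
   a smaller neighbourhood, which becomes v. *)
have [||O2 [nO2 O2P]] := ganr_homotopy_extension compactG hausdorffG
  (phi0 := gcomp (gcomp f (sbond aa')) q) (phi1 := nbhd_incl uv0)
  (nbhd_ganr u) (nbhd_point_closed_embedding v0).
- exact: nbhd_paracompact.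
- apply: (ghomotopic_trans (gcomp f (gcomp (sbond aa') (p a')))).
    by apply: ghomotopic_eq => x /=; rewrite (qP _ x).
  apply: (ghomotopic_trans (gcomp f (p a))).
    by apply/ghomotopic_compl/ghomotopic_sym.
  apply: (ghomotopic_trans (nbhd_point u)); first exact: ghomotopic_sym.
  by apply: ghomotopic_eq => x; exact: val_inj.
have [v2 v2O] : exists v2, forall z, nbhd v2 z ->
    forall s : Ug v0, set_val s = z -> O2 s.
  by apply: nbhd_shrinking => x; exact: near_subspace (nO2 x).
have [v [v0v v2v]] := nbhd_min v0 v2.
exists v, (nle_trans uv0 v0v) => w uw.
have [b0 [g0 jg0]] := (pK _ (nbhd_ganr w)).1 (nbhd_point w).
have [b [ab b0b]] := sle_directed a b0.
pose g := gcomp g0 (sbond b0b).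
(* Going back through w and going through f are homotopic after [p b], both being the inclusion of X
   into u; the uniqueness half of the expansion moves this homotopy to a term b'. *)
have [|b' [bb' gb']] := (pK _ (nbhd_ganr u)).2 b (gcomp (nbhd_incl uw) g)
  (gcomp f (sbond ab)).
  apply: (ghomotopic_trans (gcomp (nbhd_incl uw) (gcomp g0 (p b0)))).
    apply: (ghomotopic_trans (gcomp (nbhd_incl uw) (gcomp g0 (gcomp (sbond b0b)
      (p b))))).
      exact: ghomotopic_eq.
    by apply/ghomotopic_compl/ghomotopic_compl/ghomotopic_sym.
  apply: (ghomotopic_trans (gcomp (nbhd_incl uw) (nbhd_point w))).
    by apply/ghomotopic_compl/ghomotopic_sym.
  apply: (ghomotopic_trans (nbhd_point u)).
    by apply: ghomotopic_eq => x; exact: val_inj.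
  apply: (ghomotopic_trans (gcomp f (p a))) => //.
  apply: (ghomotopic_trans (gcomp f (gcomp (sbond ab) (p b)))).
    exact: ghomotopic_compl.
  exact: ghomotopic_eq.
have ab' := sle_trans ab bb'.
have [r rP] := a'mov b' ab'.
have vP s : O2 (nbhd_incl v0v s).
  by apply: (v2O (set_val s)) => //; apply: v2v; exact: (set_valP s).
pose t := gcomp q (nbhd_incl v0v).
exists (gcomp (gcomp g (sbond bb')) (gcomp r t)).
apply: (ghomotopic_trans (gcomp (gcomp (gcomp (nbhd_incl uw) g) (sbond bb'))
  (gcomp r t))).
  exact: ghomotopic_eq.
apply: (ghomotopic_trans (gcomp (gcomp (gcomp f (sbond ab)) (sbond bb'))
  (gcomp r t))).
  exact: ghomotopic_compr.
apply: (ghomotopic_trans (gcomp f (gcomp (gcomp (sbond ab) (sbond bb'))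
  (gcomp r t)))).
  exact: ghomotopic_eq.
apply: (ghomotopic_trans (gcomp f (gcomp (sbond ab') (gcomp r t)))).
  by apply/ghomotopic_compl/ghomotopic_compr; exact: sbond_comp.
apply: (ghomotopic_trans (gcomp f (gcomp (gcomp (sbond ab') r) t))).
  exact: ghomotopic_eq.
apply: (ghomotopic_trans (gcomp f (gcomp (sbond aa') t))).
  by apply/ghomotopic_compl/ghomotopic_compr.
apply: (ghomotopic_trans (gcomp (gcomp (gcomp f (sbond aa')) q)
  (nbhd_incl v0v))).
  exact: ghomotopic_eq.
apply: (ghomotopic_trans (gcomp (nbhd_incl uv0) (nbhd_incl v0v)));
  first exact: O2P.
by apply: ghomotopic_eq => s; exact: val_inj.
Qed.
Definition fnbhd (u : nbhd_fun) : set Z :=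
  [set z | 0 < u z /\ fixed_points Z H z].
Local Notation T0 := trivial_group.
Local Notation Tg A := (trivial_gspace T0 (set_type A)).

Let hZ : hausdorff_space Z. Proof. by case: pZ. Qed.

Lemma fnbhd_paracompact u : p_paracompact R (fnbhd u).
Proof.
apply: (p_paracompact_cozero pZ (@nfun_continuous u) (fixed_points_closed (H :=
  H) hZ)) => z.
by split=> -[? ?]; split.
Qed.

Lemma fnbhd_ganr u : is_ganr R (Tg (fnbhd u)).
Proof.
split=> [|W i pW ei]; first exact: fnbhd_paracompact.
(* The spaces are given the trivial action of G, so that H-equivariance of Phi places its values in
   Z[H]. *)
have [|h a Hh|Phi [cPhi Phi_i PhiH]] := extZ (A := trivial_gspace G (fnbhd u))
    (W := trivial_gspace G W) (i := trivial_gmap G (@gfun_continuous _ _ _ i))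
      (H := H)
    (phi := set_val) ei pW.
- exact: set_val_continuous.
- by have [_ ->] : fnbhd u (set_val a) by exact: (set_valP a).
pose U := [set w : W | 0 < u (Phi w)].
have Uinv : invariant_set U by move=> g w; rewrite trivial_group_act.
have UP (s : sub_gspace Uinv) : fnbhd u (Phi (set_val s)).
  split; first exact: (set_valP s).
  by move=> h Hh; rewrite -PhiH.
pose r (s : sub_gspace Uinv) : Tg (fnbhd u) := SigSub (mem_set (UP s)).
have cr : continuous r.
  apply: continuous_sub => /=; apply: continuous_comp_fun cPhi.
  exact: set_val_continuous.
have rG g s : r (gact g s) = gact g (r s) by rewrite !trivial_group_act.
exists U, Uinv, (GMap cr rG); split=> [y|y s sy].
  apply: (@near_gt0 _ _ (fun w => u (Phi w))).
    by apply: (continuous_comp_fun cPhi); exact: nfun_continuous.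
  by rewrite Phi_i; have [] : fnbhd u (set_val y) by exact: (set_valP y).
apply: val_inj; transitivity (Phi (set_val s)) => //.
by rewrite sy Phi_i.
Qed.

Lemma fnbhd_sub u (s : fnbhd u) : nbhd u (set_val s).
Proof. by have [] : fnbhd u (set_val s) by exact: (set_valP s). Qed.

Definition fnbhd_val u (s : fnbhd u) : Ug u := SigSub (mem_set (fnbhd_sub s)).

Lemma fnbhd_val_continuous u : continuous (@fnbhd_val u).
Proof. by apply: continuous_sub; exact: set_val_continuous. Qed.

Lemma fnbhd_fixed u v (f : Ug v -> Ug u) (s : fnbhd v) :
  (forall g s, f (gact g s) = gact g (f s)) ->
  fnbhd u (set_val (f (fnbhd_val s))).
Proof.
move=> fG; split; first exact: (set_valP (f _)).
move=> h Hh; have <- : set_val (gact h (f (fnbhd_val s))) =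
  gact h (set_val (f (fnbhd_val s))) by [].
rewrite -fG; congr (set_val (f _)); apply: val_inj => /=.
by have [_ ->] : fnbhd v (set_val s) by exact: (set_valP s).
Qed.

(** Takes a bare equivariant function, so that it applies to every stage of a homotopy as well as to
    G-maps. *)
Definition fix_fun u v (f : Ug v -> Ug u)
  (fG : forall g s, f (gact g s) = gact g (f s)) (s : fnbhd v) : fnbhd u :=
  SigSub (mem_set (fnbhd_fixed s fG)).

Lemma fix_fun_continuous u v (f : Ug v -> Ug u)
    (fG : forall g s, f (gact g s) = gact g (f s)) :
  continuous f -> continuous (fix_fun fG).
Proof.
move=> cf; apply: continuous_sub.
have c := continuous_comp_fun (@fnbhd_val_continuous v) cf.
exact: (continuous_comp_fun c (@set_val_continuous _ (nbhd u))).
Qed.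
Definition fix_gmap u v (f : gmap (Ug v) (Ug u)) :
  gmap (Tg (fnbhd v)) (Tg (fnbhd u)).
Proof.
exact: (trivial_gmap T0 (@fix_fun_continuous u v f (@gfun_equivariant _ _ _ f)
  (@gfun_continuous _ _ _ f))).
Defined.

Lemma fix_gmap_homotopic u v (f0 f1 : gmap (Ug v) (Ug u)) :
  ghomotopic R f0 f1 -> ghomotopic R (fix_gmap f0) (fix_gmap f1).
Proof.
move=> /ghomotopicRP[F [cF FG F0 F1]]; apply/ghomotopicRP.
pose K (p : fnbhd v * R) : fnbhd u :=
  fix_fun (f := fun s => F (s, snd p)) (fun g s => FG g s (snd p)) (fst p).
exists K; split.
- have c1 : continuous (fun p : fnbhd v * R => (fnbhd_val p.1, p.2)).
    apply: continuous_pair; last exact: snd_continuous.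
    exact: (continuous_comp_fun (@fst_continuous _ _) (@fnbhd_val_continuous
      v)).
  have c2 := continuous_comp_fun c1 cF.
  apply: continuous_sub.
  exact: (continuous_comp_fun c2 (@set_val_continuous _ (nbhd u))).
- by move=> g x t; rewrite !trivial_group_act.
- by move=> x t t0; apply: val_inj; rewrite /= F0.
- by move=> x t t1; apply: val_inj; rewrite /= F1.
Qed.

Lemma nbhd_fun_inhabited : inhabited nbhd_fun.
Proof.
by constructor; exists (fun _ => 1) => // z; exact: cvg_cst.
Qed.

Definition fnbhd_incl u v (uv : nle u v) : gmap (Tg (fnbhd v)) (Tg (fnbhd u)) :=
  fix_gmap (nbhd_incl uv).

Definition fixed_system : gsystem R T0.
Proof.
apply: (@GSystem R T0 nbhd_fun nle (fun _ _ => id) nle_trans nbhd_fun_inhabited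
  nbhd_min (fun u => Tg (fnbhd u)) fnbhd_incl).
- by move=> u uu; apply: ghomotopic_eq => s; exact: val_inj.
- by move=> u v w uv vw uw; apply: ghomotopic_eq => s; exact: val_inj.
Defined.

Lemma fixed_system_movable : gmovable R X -> movable_system fixed_system.
Proof.
move=> /nbhd_movable movU u; have [v [uv vP]] := movU u.
exists v, uv => w uw; have [r rP] := vP w uw.
exists (fix_gmap r).
apply: (ghomotopic_trans (fix_gmap (gcomp (nbhd_incl uw) r))).
  by apply: ghomotopic_eq => s; exact: val_inj.
exact: fix_gmap_homotopic.
Qed.

Lemma fixed_point_mapP x : fixed_points X H x -> fixed_points Z H (j x).
Proof. by move=> xH h Hh; rewrite -gfun_equivariant xH. Qed.

Lemma fixed_point_map_inv x : fixed_points Z H (j x) -> fixed_points X H x.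
Proof.
by have [_ ji _] := ej; move=> xH h Hh; apply: ji; rewrite gfun_equivariant xH.
Qed.

Lemma fnbhd_pointP u (x : fixed_points X H) : fnbhd u (j (set_val x)).
Proof.
by split; [exact: nfun_gt0|exact/fixed_point_mapP/(set_valP x)].
Qed.

Definition fnbhd_point_fun u (x : fixed_points X H) : fnbhd u :=
  SigSub (mem_set (fnbhd_pointP u x)).

Lemma fnbhd_point_continuous u : continuous (fnbhd_point_fun u).
Proof.
apply: continuous_sub.
exact: (continuous_comp_fun (@set_val_continuous _ _) (@gfun_continuous _ _ _
  j)).
Qed.

Definition fnbhd_point u : gmap (Tg (fixed_points X H)) (Tg (fnbhd u)) :=
  trivial_gmap T0 (@fnbhd_point_continuous u).

Let hX : hausdorff_space X.
Proof. by have [cj ji _] := ej; exact: hausdorff_continuous_inj cj ji hZ. Qed.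

Let ejH : closed_embedding (fun x : fixed_points X H => j (set_val x)).
Proof.
apply: closed_embedding_comp ej; apply: closed_embedding_set_val.
exact: fixed_points_closed.
Qed.

(** The set A is a part of Z[H] while u must be positive on all of X. At a point of X outside X[H]
    the closed set Z[H] is avoided by a whole neighbourhood, so the condition is vacuous there. *)
Lemma fixed_shrinking (A : set Z) (O : set A) (e : fixed_points X H -> A) :
  A `<=` fixed_points Z H -> (forall x, set_val (e x) = j (set_val x)) ->
  (forall x, nbhs (e x) O) ->
  exists u, forall s : A, nbhd u (set_val s) -> O s.
Proof.
move=> AH ej' nO.
have [|u uO] := nbhd_shrinking (O := [set z | forall s : A, set_val s = z ->
  O s]).
  move=> x; have [xH|nxH] := pselect (fixed_points X H x).
    have := near_subspace (nO (SigSub (mem_set xH))).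
    by rewrite ej'.
  have nN : nbhs (j x) (~` fixed_points Z H).
    apply: open_nbhs_nbhs; split; last by move/fixed_point_map_inv.
    exact/closed_openC/fixed_points_closed.
  apply: filterS nN => z nz s sz; exfalso; apply: nz; rewrite -sz.
  exact/AH/(set_valP s).
by exists u => s us; exact: (uO _ us).
Qed.

Lemma fixed_system_associated :
  associated_with fixed_system (Tg (fixed_points X H)).
Proof.
exists fnbhd_point; split=> [u v uv|K rK].
  by apply: ghomotopic_eq => x; exact: val_inj.
have cT := trivial_group_compact; have hT := trivial_group_hausdorff.
split=> [h|u f f' ff'].
  (* Factorisation: h extends over a neighbourhood of X[H] in Z[H], which contains some
     [fnbhd u]. *)
  pose ZH := Tg (fixed_points Z H).
  have pZH : p_paracompact R ZH.
    apply: p_paracompact_closed_embedding pZ.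
    exact/closed_embedding_set_val/fixed_points_closed.
  pose e (x : fixed_points X H) : fixed_points Z H :=
    SigSub (mem_set (fixed_point_mapP (set_valP x))).
  have ee : closed_embedding e by apply: closed_embedding_sub; exact: ejH.
  have [ce _ _] := ee.
  have [O [nO OP]] := ganr_neighborhood_extension cT hT
    (i := trivial_gmap T0 ce : gmap (Tg (fixed_points X H)) ZH) h rK ee pZH.
  have [u uO] := fixed_shrinking (A := fixed_points Z H) (e := e) (fun _ => id)
    (fun _ => erefl) nO.
  have kP (s : fnbhd u) : fixed_points Z H (set_val s).
    by have [] : fnbhd u (set_val s) by exact: (set_valP s).
  pose k (s : fnbhd u) : fixed_points Z H := SigSub (mem_set (kP s)).
  have ck : continuous k by apply: continuous_sub; exact: set_val_continuous.
  have [|psi psiP] := OP (Tg (fnbhd u)) (trivial_gmap T0 ck).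
    by move=> s; apply: uO; exact: fnbhd_sub.
  exists u, psi; apply: ghomotopic_eq => x /=.
  by rewrite (psiP _ x)//; exact: val_inj.
(* Uniqueness: the homotopy on X[H] extends to a neighbourhood of X[H] in [fnbhd u]. *)
have eu : closed_embedding (fnbhd_point u).
  by apply: closed_embedding_sub; exact: ejH.
have [O [nO OP]] := ganr_homotopy_extension cT hT rK eu (fnbhd_paracompact u)
  ff'.
have [v0 v0O] := fixed_shrinking (A := fnbhd u) (e := fnbhd_point_fun u)
  (fun _ => @proj2 _ _) (fun _ => erefl) nO.
have [v [uv v0v]] := nbhd_min u v0.
exists v, uv; apply: OP => s; apply: v0O; apply: v0v; exact: (fnbhd_sub s).
Qed.

End MovableFixedPoints.

Theorem theorem3 (R : realType) (G : topGroupType)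
    (compactG : compact [set: G]) (hausdorffG : hausdorff_space G)
    (H : set G) (closedH : closed_subgroup H)
    (X : gspace G) (pX : p_paracompact R X) (movX : gmovable R X) :
  movable R (set_type (fixed_points X H)).
Proof.
have [Z [j [pZ ej extZ]]] := embed_in_extensor compactG hausdorffG pX.
exists (@fixed_system R G X Z j H); split.
- by move=> u; exact: fnbhd_ganr.
- exact: fixed_system_movable.
- exact: fixed_system_associated.
Qed.
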